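(* In the setting and under the regularity assumption of the context, the dual DRO problem $\max_{\mathbb Q\in\mathcal P}\min_{x\in\mathcal X}\mathbb E_{z\sim\mathbb Q}[\ell(x,z)]$ is equivalent to the nonconvex program $$\begin{array}{cl}\max&\displaystyle-\frac1N\sum_{i=1}^N\sum_{k=1}^K\alpha_{ik}\,\ell_k^{*1}(y_{ik},\hat z_i+v_{ik})-\nu\,\sigma_{\mathcal X}(\theta)\\ \text{s.t.}&\theta\in\mathbb R^n,\ \nu\in\mathbb R_+,\ \alpha_{ik}\in\mathbb R_+,\ v_{ik}\in\mathbb R^m,\ y_{ik}\in\mathbb R^n,\ \hat z_i+v_{ik}\in\mathcal Z\quad\forall i\in[N],k\in[K],\\ &\displaystyle\frac1N\sum_{i=1}^N\sum_{k=1}^K\alpha_{ik}y_{ik}+\nu\theta=0,\quad\frac1N\sum_{i=1}^N\sum_{k=1}^K\alpha_{ik}c(\hat z_i+v_{ik},\hat z_i)\le\rho,\quad\sum_{k=1}^K\alpha_{ik}=1\ \forall i\in[N].\end{array}$$ Given an optimal solution $(\{\alpha^\star_{ik},v^\star_{ik},y^\star_{ik}\},\theta^\star,\nu^\star)$ of this program, the discrete distribution $$\mathbb Q^\star_{\mathrm{dual}}:=\frac1N\sum_{i=1}^N\sum_{k=1}^K\alpha^\star_{ik}\delta_{\hat z_i+v^\star_{ik}}$$ belongs to $\mathcal P$ and attains the maximum in the dual DRO problem. Furthermore, there exists an optimal solution in which at most $\min\{N+n+1,KN\}$ of the weights $\{\alpha_{ik}^\star\}$ are nonzero. Consequently, there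 exists a least-favorable distribution (a maximizer of the dual DRO problem) supported on at most $\min\{N+n+1,KN\}$ points.
   Context: Notation: $[n]=\{1,\dots,n\}$; $\mathcal P(\mathcal Z)$ is the set of Borel probability measures on $\mathcal Z$. $\ell_k^{*1}(w,z)=\sup_{x\in\mathbb R^n}\{w^\top x-\ell_k(x,z)\}$ is the conjugate of $\ell_k$ in its first argument for fixed $z$; $\sigma_{\mathcal X}(\theta)=\sup_{x\in\mathcal X}\theta^\top x$ is the support function. Products with a zero coefficient are understood through the perspective convention ($tf(w/t)$ at $t=0$ denotes the recession function of $f$ at $w$), so a term $\alpha_{ik}\ell_k^{*1}(y_{ik},\cdot)$ with $\alpha_{ik}=0$ or $\nu\sigma_{\mathcal X}(\theta)$ with $\nu=0$ equals $0$. Setting. $\mathcal X\subseteq\mathbb R^n$, $\mathcal Z\subseteq\mathbb R^m$. A transportation cost $c:\mathcal Z\times\mathcal Z\to\mathbb R_+$ is lower semicontinuous, satisfies $c(z,z)=0$ for all $z$, and $c(\cdot,\hat z)$ is convex for every fixed $\hat z\in\mathcal Z$. The optimal transport discrepancy is $\mathrm{OT}_c(\mathbb P,\mathbb Q)=\min_{\gamma}\mathbb E_{(z,\hat z)\sim\gamma}[c(z,\hat z)]$ over couplings $\gamma$ of $\mathbb P$ and $\mathbb Q$. Given $\hat z_1,\dots,\hat z_N\in\mathcal Z$, let $\hat{\mathbb P}=\frac1N\sum_{i=1}^N\delta_{\hat z_i}$; given $\rho>0$, let $\mathcal P=\{\mathbb P\in\mathcal P(\mathcal Z):\mathrm{OT}_c(\mathbb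 P,\hat{\mathbb P})\le\rho\}$. Regularity assumption. (i) $\mathcal X$ is nonempty and convex; there exist $\mathbb Q_0\in\mathcal P$ and $x_0\in\mathcal X$ such that $x\mapsto\mathbb E_{z\sim\mathbb Q_0}[\ell(x,z)]$ is inf-compact on $\mathcal X$ (all sublevel sets are compact) and $\mathbb E_{z\sim\mathbb Q_0}[\ell(x_0,z)]>-\infty$; $\mathcal Z$ is nonempty, closed and convex. (ii) $\ell(x,z)=\max_{k\in[K]}\ell_k(x,z)$ with $K\ge2$, where each $\ell_k:\mathbb R^n\times\mathbb R^m\to\mathbb R$ is real-valued, convex in its first and concave in its second argument. (iii) There exist a norm $\|\cdot\|$ on $\mathbb R^m$ and $p\ge1$ with $c(z,\hat z)\ge\|z-\hat z\|^p$ for all $z,\hat z\in\mathcal Z$; moreover, if $p=1$, then for every $x\in\mathcal X$ there exist $g>0$, $\hat z_0\in\mathcal Z$ and $r\in[0,1)$ such that $\ell(x,z)\le g[1+\|z-\hat z_0\|^r]$ for all $z\in\mathcal Z$. *)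

(* Defs.v *)
From HB Require Import structures.
From mathcomp Require Import all_boot all_order all_algebra.
From mathcomp Require Import all_classical all_reals all_analysis.

Set Implicit Arguments.
Unset Strict Implicit.
Unset Printing Implicit Defensive.

Import Order.TTheory GRing.Theory Num.Theory.
Import numFieldNormedType.Exports.

Local Open Scope classical_set_scope.
Local Open Scope ring_scope.

(* R^m with its Borel sigma-algebra. *)
Definition borel (R : realType) (m : nat) :
    measurableType (sigma_display (@open 'rV[R]_m)) :=
  g_sigma_algebraType (@open 'rV[R]_m).

(* The proofs [w0] and [w1] occur only so that the probability structure below
   can be attached to the constant. *)
Definition discrete_probability (d : measure_display) (T : measurableType d)
    (R : realType) (I : finType) (w : I -> R) (p : I -> T)
    (w0 : forall i, 0 <= w i) (w1 : \sum_i w i = 1) (A : set T) : \bar R :=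
  (\sum_i (w i)%:E * dirac (p i) A)%E.

Section discrete_probability.
Context (d : measure_display) (T : measurableType d) (R : realType).
Context (I : finType) (w : I -> R) (p : I -> T).
Hypotheses (w0 : forall i, 0 <= w i) (w1 : \sum_i w i = 1).
Local Open Scope ereal_scope.

Local Notation mu := (discrete_probability p w0 w1).

Let mu0 : mu set0 = 0.
Proof. by rewrite /discrete_probability big1// => i _; rewrite measure0 mule0. Qed.

Let mu_ge0 A : 0 <= mu A.
Proof. by apply: sume_ge0 => i _; rewrite mule_ge0 ?lee_fin. Qed.

Let mu_sigma_additive : semi_sigma_additive mu.
Proof.
move=> F mF tF mUF.
rewrite [X in X @ _ --> _](_ : _ = (fun n =>
    \sum_i (w i)%:E * \sum_(0 <= j < n) dirac (p i) (F j))); last first.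
  apply/funext => n; rewrite /discrete_probability exchange_big/=.
  by apply: eq_bigr => i _; rewrite ge0_sume_distrr// => j _.
apply: cvg_nnesum => [i _|i _].
  apply: nearW => n.
  by rewrite mule_ge0 ?lee_fin// sume_ge0.
apply: cvgeZl => //; exact: (@measure_semi_sigma_additive _ _ _ (dirac (p i))).
Qed.

HB.instance Definition _ :=
  isMeasure.Build _ _ _ mu mu0 mu_ge0 mu_sigma_additive.

Let mu_setT : mu setT = 1.
Proof.
rewrite /discrete_probability -[RHS]/(1%R%:E) -w1 -sumEFin.
by apply: eq_bigr => i _; rewrite diracT mule1.
Qed.

HB.instance Definition _ := Measure_isProbability.Build _ _ _ mu mu_setT.

End discrete_probability.

Section setting.
Context (R : realType).

Definition dot (n : nat) (w x : 'rV[R]_n) : R := (w *m x^T) 0 0.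

Definition is_norm (m : nat) (nrm : 'rV[R]_m -> R) : Prop :=
  [/\ forall z z', nrm (z + z') <= nrm z + nrm z',
      forall a z, nrm (a *: z) = `|a| * nrm z
    & forall z, nrm z = 0 -> z = 0].

Definition conjugate1 (n m : nat) (f : 'rV[R]_n -> 'rV[R]_m -> R)
    (w : 'rV[R]_n) (z : 'rV[R]_m) : \bar R :=
  ereal_sup [set (dot w x - f x z)%:E | x in [set: 'rV[R]_n]].

Definition support_function (n : nat) (X : set 'rV[R]_n)
    (theta : 'rV[R]_n) : \bar R :=
  ereal_sup [set (dot theta x)%:E | x in X].

(* Only the values of [c] on [Z `*` Z] are constrained; lower semicontinuity
   is with respect to the topology induced on [Z `*` Z]. *)
Record transport_cost (m : nat) (Z : set 'rV[R]_m)
    (c : 'rV[R]_m -> 'rV[R]_m -> R) : Prop := TransportCost {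
  cost_ge0 : forall z z', Z z -> Z z' -> 0 <= c z z' ;
  cost_lsc : @lower_semicontinuous (subspace (Z `*` Z)) R
    (fun w : 'rV[R]_m * 'rV[R]_m => (c w.1 w.2)%:E) ;
  cost_diag : forall z, Z z -> c z z = 0 ;
  cost_convex : forall z', Z z' -> convex_function Z (fun z => c z z')
}.

Section ambiguity.
Variables (m : nat) (Z : set 'rV[R]_m) (c : 'rV[R]_m -> 'rV[R]_m -> R).

Definition coupling (P Q : probability (borel R m) R)
    (gamma : probability (borel R m * borel R m)%type R) : Prop :=
  (forall A, measurable A -> gamma (A `*` setT) = P A) /\
  (forall A, measurable A -> gamma (setT `*` A) = Q A).

(* For P and Q concentrated on Z every coupling is concentrated on Z x Z, the
   domain of the transportation cost, to which the integral is restricted. *)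
Definition OT (P Q : probability (borel R m) R) : \bar R :=
  ereal_inf [set (\int[gamma]_(w in Z `*` Z) (c w.1 w.2)%:E)%E
            | gamma in coupling P Q].

Lemma uniform_weights_ge0 (N : nat) (i : 'I_N) : 0 <= N%:R^-1 :> R.
Proof. by rewrite invr_ge0. Qed.

Lemma uniform_weights_sum (N : nat) : (0 < N)%N -> \sum_(i < N) N%:R^-1 = 1 :> R.
Proof.
move=> N0; rewrite sumr_const card_ord -[_ *+ _]mulr_natr mulVf//.
by rewrite pnatr_eq0 -lt0n.
Qed.

Definition empirical (N : nat) (N0 : (0 < N)%N) (zhat : 'I_N -> 'rV[R]_m) :
    probability (borel R m) R :=
  discrete_probability (zhat : 'I_N -> borel R m)
    (@uniform_weights_ge0 N) (uniform_weights_sum N0).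

(* P(Z) is the set of Borel probability measures P on R^m with P(Z) = 1. *)
Definition ambiguity_set (N : nat) (N0 : (0 < N)%N) (zhat : 'I_N -> 'rV[R]_m)
    (rho : R) : set (probability (borel R m) R) :=
  [set P : probability (borel R m) R |
    P Z = 1%E /\ (OT P (empirical N0 zhat) <= rho%:E)%E].

End ambiguity.

Section loss.
Variables (n m K : nat) (l : 'I_K -> 'rV[R]_n -> 'rV[R]_m -> R).

Definition loss (x : 'rV[R]_n) (z : 'rV[R]_m) : \bar R :=
  \big[maxe/-oo%E]_(k < K) (l k x z)%:E.

Definition expected_loss (Q : probability (borel R m) R) (x : 'rV[R]_n) :
    \bar R :=
  (\int[Q]_(z in [set: borel R m]) loss x z)%E.

Definition dual_DRO_objective (X : set 'rV[R]_n)
    (Q : probability (borel R m) R) : \bar R :=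
  ereal_inf [set expected_loss Q x | x in X].

End loss.

Definition inf_compact_on (n : nat) (X : set 'rV[R]_n)
    (f : 'rV[R]_n -> \bar R) : Prop :=
  forall a : R, compact [set x | X x /\ (f x <= a%:E)%E].

Record regularity (n m K : nat) (X : set 'rV[R]_n) (Z : set 'rV[R]_m)
    (c : 'rV[R]_m -> 'rV[R]_m -> R)
    (l : 'I_K -> 'rV[R]_n -> 'rV[R]_m -> R)
    (PP : set (probability (borel R m) R)) : Prop := Regularity {
  reg_X : X !=set0 /\ convex_set X ;
  reg_inf_compact : exists Q0 x0, [/\ PP Q0, X x0,
    inf_compact_on X (expected_loss l Q0)
    & (-oo < expected_loss l Q0 x0)%E] ;
  reg_Z : [/\ Z !=set0, closed Z & convex_set Z] ;
  reg_K : (2 <= K)%N ;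
  reg_convex : forall k z, convex_function setT (fun x => l k x z) ;
  reg_concave : forall k x, convex_function setT (fun z => - l k x z) ;
  reg_growth : exists (nrm : 'rV[R]_m -> R) (p : R),
    [/\ is_norm nrm, 1 <= p,
        forall z z', Z z -> Z z' -> nrm (z - z') `^ p <= c z z'
      & p = 1 -> forall x, X x -> exists (g : R) (z0 : 'rV[R]_m) (r : R),
          [/\ 0 < g, Z z0, 0 <= r < 1
            & forall z, Z z ->
                (loss l x z <= (g * (1 + nrm (z - z0) `^ r))%:E)%E]]
}.

Record variables (n m N K : nat) := ProgramVariables {
  theta : 'rV[R]_n ;
  nu : R ;
  alpha : 'I_N -> 'I_K -> R ;
  v : 'I_N -> 'I_K -> 'rV[R]_m ;
  y : 'I_N -> 'I_K -> 'rV[R]_n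
}.

Section program.
Variables (n m N K : nat) (X : set 'rV[R]_n) (Z : set 'rV[R]_m).
Variables (c : 'rV[R]_m -> 'rV[R]_m -> R).
Variables (l : 'I_K -> 'rV[R]_n -> 'rV[R]_m -> R).
Variables (zhat : 'I_N -> 'rV[R]_m) (rho : R).

(* In \bar R the product of 0 and an infinite value is 0, as required by the
   perspective convention; the conjugates and the support function never take
   the value -oo when X is nonempty. *)
Definition program_objective (s : variables n m N K) : \bar R :=
  (- ((N%:R^-1)%:E * \sum_(i < N) \sum_(k < K)
        (alpha s i k)%:E * conjugate1 (l k) (y s i k) (zhat i + v s i k)%R)
   - (nu s)%:E * support_function X (theta s))%E.

Record program_feasible (s : variables n m N K) : Prop := ProgramFeasible {
  nu_ge0 : 0 <= nu s ;
  alpha_ge0 : forall i k, 0 <= alpha s i k ;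
  atom_in : forall i k, Z (zhat i + v s i k) ;
  stationarity :
    N%:R^-1 *: (\sum_(i < N) \sum_(k < K) alpha s i k *: y s i k)
    + nu s *: theta s = 0 ;
  budget : N%:R^-1 * (\sum_(i < N) \sum_(k < K)
      alpha s i k * c (zhat i + v s i k) (zhat i)) <= rho ;
  alpha_sum : forall i, \sum_(k < K) alpha s i k = 1
}.

Lemma dual_weights_ge0 (s : variables n m N K) : program_feasible s ->
  forall ik : 'I_N * 'I_K, 0 <= N%:R^-1 * alpha s ik.1 ik.2.
Proof. by move=> fs ik; rewrite mulr_ge0 ?invr_ge0//; exact: alpha_ge0. Qed.

Lemma dual_weights_sum (N0 : (0 < N)%N) (s : variables n m N K) :
  program_feasible s ->
  \sum_(ik : 'I_N * 'I_K) N%:R^-1 * alpha s ik.1 ik.2 = 1.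
Proof.
move=> fs; rewrite -(pair_bigA _ (fun i k => N%:R^-1 * alpha s i k))/=.
rewrite -[RHS](uniform_weights_sum N0); apply: eq_bigr => i _.
by rewrite -mulr_sumr (alpha_sum fs) mulr1.
Qed.

(* Q_dual = 1/N sum_{i,k} alpha_ik delta_{zhat_i + v_ik} *)
Definition dual_distribution (N0 : (0 < N)%N) (s : variables n m N K)
    (fs : program_feasible s) : probability (borel R m) R :=
  discrete_probability
    (fun ik : 'I_N * 'I_K => zhat ik.1 + v s ik.1 ik.2 : borel R m)
    (dual_weights_ge0 fs) (dual_weights_sum N0 fs).

End program.

Definition is_maximizer (T : Type) (D : set T) (f : T -> \bar R) (t : T) : Prop :=
  D t /\ forall t', D t' -> (f t' <= f t)%E.

End setting.

(* Main.v *)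
Require Import Defs.
From mathcomp Require Import all_boot all_order all_algebra.
From mathcomp Require Import all_classical all_reals all_analysis.
From mathcomp Require Import measurable_realfun ring lra.
Import Order.TTheory GRing.Theory Num.Theory.
Import numFieldNormedType.Exports.

(** A point of the program is a mixture [s = (alpha, z)] of [N * K] atoms
    together with Fenchel multipliers.  Multiplying out the conjugates gives, for
    every [x] in [X], [objective s <= F(s, x)] with
    [F(s, x) = 1/N \sum_ik alpha_ik l_k(x, z_ik)], which is at most the expected
    loss of the associated discrete distribution; so the program is at most the
    dual DRO problem.

    Conversely let [b] be the value of the dual DRO problem.  A coupling of [Q]
    with the empirical measure shows that the expected loss of [Q] at [x] is at
    most [lam rho + 1/N \sum_i sup_(k, z) (l_k(x, z) - lam c(z, zhat_i))] for all
    [lam > 0], hence so is [b].  The right-hand side is the supremum over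
    mixtures [s] of [F(s, x) + lam (rho - cost s)].  Both [F(., x)] and [- cost]
    are concave-like in [s] (average [alpha] and [alpha z]) and [F(s, .)] is
    convex, so separation in finite dimension produces, for finitely many [x],
    a mixture with almost [cost s <= rho] and [F(s, x) >= b].  An ultrafilter
    limit of such mixtures satisfies both exactly for all [x] in [X]: by the
    growth condition atoms whose weight vanishes can be discarded.  Fenchel
    duality on [X] supplies the multipliers, and as the objective is linear in
    [alpha] under [N + n + 1] linear constraints, a simplex-type reduction
    leaves at most [N + n + 1] nonzero weights. *)

Set Implicit Arguments.
Unset Strict Implicit.
Unset Printing Implicit Defensive.

Local Open Scope classical_set_scope.
Local Open Scope ring_scope.

(** * Subgradients of convex functions *)

Section convexity.
Context {R : realType}.

Definition convex_fct (I : Type) (p : (I -> R) -> R) := forall u v t,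
  0 <= t <= 1 -> p (fun i => t * u i + (1 - t) * v i) <= t * p u + (1 - t) * p v.

(** Hahn-Banach extension, one coordinate at a time: by convexity every left difference quotient in
    the new coordinate lies below every right one, so a slope fits in between. *)
Lemma subgradient_seq (I : eqType) (p : (I -> R) -> R) (s : seq I) :
  uniq s -> convex_fct p ->
  exists w : I -> R, forall u, (forall i, i \notin s -> u i = 0) ->
    p (fun=> 0) + \sum_(i <- s) w i * u i <= p u.
Proof.
move=> us cp; elim: s us => [_|i s IH /= /andP[i_s us]].
  exists (fun=> 0) => u u0; rewrite big_nil addr0.
  by rewrite (_ : u = fun=> 0)//; apply/funext => i; rewrite u0.
have [w hw] := IH us; set p0 := p _ in hw *.
pose L (u : I -> R) := \sum_(j <- s) w j * u j.
pose supp (u : I -> R) := forall j, j \notin i :: s -> u j = 0.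
have key u v : supp u -> supp v -> 0 < u i -> v i < 0 ->
    (p0 + L v - p v) / - v i <= (p u - L u - p0) / u i.
  move=> su sv ui vi.
  rewrite ler_pdivrMr ?oppr_gt0// mulrAC ler_pdivlMr//.
  have ab0 : 0 < u i - v i by lra.
  (* With this [t] the coordinate [i] of [t * u + (1 - t) * v] vanishes, so the induction hypothesis
     applies to the combination. *)
  pose t := - v i / (u i - v i).
  have t0 : 0 <= t by rewrite divr_ge0//; lra.
  have t1 : t <= 1 by rewrite ler_pdivrMr//; lra.
  have := hw (fun j => t * u j + (1 - t) * v j).
  have -> : \sum_(j <- s) w j * (t * u j + (1 - t) * v j) = t * L u + (1 - t) * L v.
    by rewrite !mulr_sumr -big_split/=; apply: eq_bigr => j _; ring.
  have t01 : 0 <= t <= 1 by rewrite t0.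
  move=> h; have {h} := le_trans (h _) (cp u v t t01).
  have supp0 j : j \notin s -> t * u j + (1 - t) * v j = 0.
    move=> js; have [->|ji] := eqVneq j i.
      by rewrite /t; field; rewrite gt_eqF.
    by rewrite su ?sv ?mulr0 ?addr0// inE negb_or ji.
  move=> /(_ supp0); rewrite -(ler_pM2l ab0).
  have -> : (u i - v i) * (p0 + (t * L u + (1 - t) * L v)) =
     (u i - v i) * p0 - v i * L u + u i * L v by rewrite /t; field; rewrite gt_eqF.
  have -> : (u i - v i) * (t * p u + (1 - t) * p v) = - v i * p u + u i * p v.
    by rewrite /t; field; rewrite gt_eqF.
  by lra.
pose S := [set (p0 + L v - p v) / - v i | v in [set v | supp v /\ v i < 0]].
pose e (a : R) (j : I) := if j == i then a else 0.
have supp_e a : supp (e a).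
  by move=> j; rewrite inE negb_or /e => /andP[/negbTE->].
have e_i a : e a i = a by rewrite /e eqxx.
have S0 : S !=set0.
  exists ((p0 + L (e (-1)) - p (e (-1))) / - e (-1) i), (e (-1)) => //.
  by split => //; rewrite e_i ltrN10.
have ubS u : supp u -> 0 < u i -> ubound S ((p u - L u - p0) / u i).
  by move=> su ui _ [v [sv vi] <-]; exact: key.
have hS : has_sup S by split => //; eexists; apply: (ubS (e 1)); rewrite ?e_i.
(* The new slope is the supremum of the left quotients; the sign of [u i] decides which side of the
   bound is used. *)
exists (fun j => if j == i then sup S else w j) => u su.
rewrite big_cons eqxx.
have -> : \sum_(j <- s) (if j == i then sup S else w j) * u j = L u.
  apply: eq_big_seq => j js; case: eqP => // ji.
  by move: i_s; rewrite -ji js.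
case: (ltrgtP (u i) 0) => ui.
- have : (p0 + L u - p u) / - u i <= sup S.
    by apply: ub_le_sup; [exact: hS.2|exists u].
  by rewrite ler_pdivrMr ?oppr_gt0//; lra.
- have : sup S <= (p u - L u - p0) / u i by apply: ge_sup => //; exact: ubS.
  by rewrite ler_pdivlMr//; lra.
- rewrite ui mulr0 add0r; apply: hw => j js; have [->//|ji] := eqVneq j i.
  by rewrite su// inE negb_or ji.
Qed.

Lemma subgradient (I : finType) (p : (I -> R) -> R) : convex_fct p ->
  exists w : I -> R, forall u, p (fun=> 0) + \sum_i w i * u i <= p u.
Proof.
move=> /(subgradient_seq (enum_uniq I))[w hw].
exists w => u; have := hw u; rewrite big_enum/=; apply => i.
by rewrite mem_enum.
Qed.

Lemma convex_functionP (V : lmodType R) (D : set V) (f : V -> R) :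
  convex_function D f -> forall x y t, D x -> D y -> 0 <= t <= 1 ->
  f (t *: x + (1 - t) *: y) <= t * f x + (1 - t) * f y.
Proof.
move=> cf x y t Dx Dy /andP[t0 t1].
exact: (cf (Itv01 t0 t1) x y (mem_set Dx) (mem_set Dy)).
Qed.

Lemma convex_setP (V : lmodType R) (D : set V) : convex_set D ->
  forall x y t, D x -> D y -> 0 <= t <= 1 -> D (t *: x + (1 - t) *: y).
Proof.
move=> cD x y t Dx Dy /andP[t0 t1].
exact: set_mem (cD x y (Itv01 t0 t1) (mem_set Dx) (mem_set Dy)).
Qed.

Lemma dotE n (w x : 'rV[R]_n) : dot w x = \sum_j w 0 j * x 0 j.
Proof. by rewrite /dot mxE; apply: eq_bigr => j _; rewrite mxE. Qed.

Lemma dotDr n (w x y : 'rV[R]_n) : dot w (x + y) = dot w x + dot w y.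
Proof. by rewrite /dot linearD mulmxDr mxE. Qed.

Lemma dotZr n (w x : 'rV[R]_n) a : dot w (a *: x) = a * dot w x.
Proof. by rewrite /dot linearZ/= -scalemxAr mxE. Qed.

Lemma dotDl n (w x y : 'rV[R]_n) : dot (w + y) x = dot w x + dot y x.
Proof. by rewrite /dot mulmxDl mxE. Qed.

Lemma dotZl n (w x : 'rV[R]_n) a : dot (a *: w) x = a * dot w x.
Proof. by rewrite /dot -scalemxAl mxE. Qed.

Lemma dot0l n (x : 'rV[R]_n) : dot 0 x = 0.
Proof. by rewrite /dot mul0mx mxE. Qed.

Lemma dot_suml n (I : Type) (r : seq I) (P : pred I) (w : I -> 'rV[R]_n) x :
  dot (\sum_(i <- r | P i) w i) x = \sum_(i <- r | P i) dot (w i) x.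
Proof.
by rewrite /dot mulmx_suml summxE.
Qed.

Lemma convex_subgradient n (f : 'rV[R]_n -> R) x0 : convex_function setT f ->
  exists w, forall x, f x0 + dot w (x - x0) <= f x.
Proof.
move=> /convex_functionP cf.
pose p (u : 'I_n -> R) := f (x0 + \row_j u j).
have cp : convex_fct p.
  move=> u v t t01; apply: le_trans (cf _ _ _ _ _ t01) => //.
  rewrite /p le_eqVlt; apply/orP; left; apply/eqP; congr f.
  by apply/rowP => j; rewrite !mxE; ring.
have [w hw] := subgradient cp; exists (\row_j w j) => x.
have := hw (fun j => (x - x0) 0 j).
rewrite /p (_ : \row_j (x - x0) 0 j = x - x0); last by apply/rowP => j; rewrite mxE.
rewrite [x0 + (x - x0)]addrC subrK (_ : \row__ 0 = 0) ?addr0; last by apply/rowP => j; rewrite !mxE.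
move=> /(le_trans _); apply; rewrite lerD2l dotE ler_sum// => j _.
by rewrite mxE.
Qed.

Lemma le_coord_norm n (x : 'rV[R]_n) j : `|x 0 j| <= `|x|.
Proof.
rewrite [leRHS]/Num.norm /= mx_normrE.
exact: (le_bigmax _ (fun k : 'I_1 * 'I_n => `|x k.1 k.2|) (0, j)).
Qed.

Lemma le_dot_norm n (w x : 'rV[R]_n) :
  `|dot w x| <= (\sum_j `|w 0 j|) * `|x|.
Proof.
rewrite dotE mulr_suml (le_trans (ler_norm_sum _ _ _))// ler_sum// => j _.
by rewrite normrM ler_wpM2l// le_coord_norm.
Qed.

Lemma lipschitz_rV_continuous n (f : 'rV[R]_n -> R) B :
  (forall x y, `|f x - f y| <= B * `|x - y|) -> continuous f.
Proof.
move=> fB x; apply/(@cvgrPdist_lt _ _ _ _ (nbhs_filter x)) => e e0.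
have eB : 0 < e / (`|B| + 1) by rewrite divr_gt0// ltr_wpDl.
near=> y; apply: (le_lt_trans (fB _ _)).
apply: (@le_lt_trans _ _ ((`|B| + 1) * `|x - y|)).
  by rewrite ler_wpM2r// (le_trans (ler_norm _))// lerDl.
rewrite mulrC -ltr_pdivlMr ?ltr_wpDl//; near: y.
Unshelve. all: by end_near. Qed.

Lemma dot_continuous n (w : 'rV[R]_n) : continuous (dot w).
Proof.
apply: (@lipschitz_rV_continuous _ _ (\sum_j `|w 0 j|)) => x y.
apply: le_trans (le_dot_norm w (x - y)).
by rewrite dotDr -[- y]scaleN1r dotZr mulN1r.
Qed.

(** The affine minorant given by a subgradient at [x0] is continuous and touches [f] at [x0]. *)
Lemma convex_lower_semicontinuous n (f : 'rV[R]_n -> R) x0 e :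
  convex_function setT f -> 0 < e -> \forall x \near x0, f x0 - e < f x.
Proof.
move=> cf e0; have [w hw] := convex_subgradient x0 cf.
have : dot w x @[x --> x0] --> dot w x0 by exact: dot_continuous.
move=> /cvgrPdist_lt /(_ _ e0); apply: filterS => x.
move=> h; apply: lt_le_trans (hw x); rewrite -[x0 in x - x0]scale1r.
by rewrite -scaleNr dotDr dotZr; move: h; rewrite ltr_norml => /andP[]; lra.
Qed.

End convexity.

(** * Norms and growth *)

Section growth.
Context {R : realType}.

Section norm.
Variables (m : nat) (nrm : 'rV[R]_m -> R).
Hypothesis nrmP : is_norm nrm.

Lemma is_norm0 : nrm 0 = 0.
Proof. by have [_ h _] := nrmP; rewrite -(scale0r 0) h normr0 mul0r. Qed.

Lemma is_normN z : nrm (- z) = nrm z.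
Proof. by have [_ h _] := nrmP; rewrite -scaleN1r h normrN1 mul1r. Qed.

Lemma is_norm_ge0 z : 0 <= nrm z.
Proof.
have [h _ _] := nrmP; have := h z (- z).
by rewrite subrr is_norm0 is_normN; lra.
Qed.

Lemma is_norm_le z : nrm z <= (\sum_j nrm (delta_mx 0 j)) * `|z|.
Proof.
have [hD hZ _] := nrmP.
rewrite {1}(row_sum_delta z) mulr_suml.
apply: (big_ind2 (fun x y => nrm x <= y)) => [|x y x' y' hx hx'|j _].
- by rewrite is_norm0.
- by rewrite (le_trans (hD _ _))// lerD.
- by rewrite hZ mulrC ler_wpM2l ?is_norm_ge0// le_coord_norm.
Qed.

Lemma is_norm_continuous : continuous nrm.
Proof.
have [hD _ _] := nrmP.
apply: (@lipschitz_rV_continuous _ _ _ (\sum_j nrm (delta_mx 0 j))) => x y.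
apply: le_trans (is_norm_le _).
have := hD (x - y) y; have := hD (y - x) x; rewrite !subrK -[y - x]opprB is_normN.
by rewrite ler_norml; lra.
Qed.

(** Equivalence of norms: [nrm] is continuous and attains a positive minimum on the compact unit
    sphere of the sup norm. *)
Lemma is_norm_ge : exists2 k : R, 0 < k & forall z, k * `|z| <= nrm z.
Proof.
have [_ hZ h0] := nrmP.
(* In the zero space the sphere is empty, so that case is treated apart. *)
have [[z0 z00]|nz] := pselect (exists z : 'rV[R]_m, z != 0); last first.
  exists 1 => // z; suff -> : z = 0 by rewrite normr0 mulr0 is_norm0.
  by apply/eqP; apply: contra_notT nz => zN0; exists z.
pose S := [set z : 'rV[R]_m | `|z| = 1].
have normS z : z != 0 -> S (`|z|^-1 *: z).
  by move=> z0'; rewrite /S/= normrZ normfV normr_id mulVf// normr_eq0.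
have S0 : S !=set0 by exists (`|z0|^-1 *: z0); exact: normS.
have cS : compact S.
  apply: bounded_closed_compact.
    by exists 1; split => // M M1 z /= ->; exact: ltW.
  apply: (@preimage_closed _ _ (fun z : 'rV[R]_m => `|z|) [set 1]).
    by move=> z _; exact: norm_continuous.
  exact: closed_eq.
have [z /set_mem Sz minz] := compact_EVT_min S0 cS (continuous_subspaceT is_norm_continuous).
exists (nrm z).
  rewrite lt_neqAle is_norm_ge0 andbT eq_sym; apply/eqP => /h0 zE.
  by move: Sz; rewrite /S/= zE normr0 => /esym/eqP; rewrite oner_eq0.
move=> x; have [->|x0] := eqVneq x 0; first by rewrite normr0 mulr0 is_norm0.
have := minz _ (mem_set (normS _ x0)).
by rewrite hZ normfV normr_id mulrC ler_pdivlMr// normr_gt0.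
Qed.

End norm.

(** The two powers balance at [T], where [B * T^r = lam * T^p]: below [T] a constant suffices, above
    it the higher power wins. *)
Lemma powR_dominated (r p B lam : R) : 0 <= r < p -> 0 <= B -> 0 < lam ->
  exists C, forall t, 0 <= t -> B * t `^ r <= C + lam * t `^ p.
Proof.
move=> /andP[r0 rp] B0 lam0.
pose T := (B / lam) `^ ((p - r)^-1).
have pr0 : 0 < p - r by rewrite subr_gt0.
have T0 : 0 <= T by exact: powR_ge0.
exists (B * T `^ r) => t t0; have [tT|Tt] := leP t T.
  rewrite -[leLHS]addr0 lerD//; last by rewrite mulr_ge0 ?powR_ge0// ltW.
  by rewrite ler_wpM2l// ge0_ler_powR.
have tgt0 : 0 < t by exact: le_lt_trans Tt.
have : T `^ (p - r) <= t `^ (p - r) by rewrite ge0_ler_powR ?(ltW pr0)// ltW.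
rewrite -powRrM mulVf ?gt_eqF// powRr1 ?divr_ge0 ?(ltW lam0)// ler_pdivrMr// => h.
rewrite -[B * t `^ r]add0r lerD ?mulr_ge0 ?powR_ge0//.
rewrite -[p](subrK r) powRD ?(gt_eqF tgt0) ?implybT// mulrA ler_wpM2r ?powR_ge0//.
by rewrite mulrC.
Qed.

(** * Growth of the loss and coercivity of the cost *)

Section regular.
Variables (n m K : nat) (X : set 'rV[R]_n) (Z : set 'rV[R]_m).
Variables (c : 'rV[R]_m -> 'rV[R]_m -> R) (l : 'I_K -> 'rV[R]_n -> 'rV[R]_m -> R).
Variable PP : set (probability (borel R m) R).
Hypothesis hreg : regularity X Z c l PP.

Lemma le_loss k x z : ((l k x z)%:E <= loss l x z)%E.
Proof. exact: (le_bigmax _ (fun k => (l k x z)%:E)). Qed.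

(** An arbitrarily small multiple of the cost outgrows each piece of the loss. For [p = 1] this is
    the sublinear growth condition; for [p > 1] concavity in [z] already limits the loss to linear
    growth. *)
Lemma loss_dominated x u lam k : X x -> Z u -> 0 < lam ->
  exists C, forall z, Z z -> l k x z <= C + lam * c z u.
Proof.
move=> Xx Zu lam0; have [nrm [p [nrmP p1 cp g1]]] := reg_growth hreg.
have [hD hZ _] := nrmP.
have [pE|pN1] := eqVneq p 1.
  have [g [z0 [r [g0 Zz0 /andP[r0 r1] hg]]]] := g1 pE _ Xx.
  have [C hC] : exists C, forall t, 0 <= t -> g * t `^ r <= C + lam * t `^ 1.
    by apply: powR_dominated; rewrite ?r0// ltW.
  exists (g + C + lam * nrm (u - z0)) => z Zz.
  have := le_trans (le_loss k x z) (hg z Zz); rewrite lee_fin => h.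
  have := hD (z - u) (u - z0); rewrite addrA subrK => h2.
  have t0 : 0 <= nrm (z - u) + nrm (u - z0) by rewrite addr_ge0// is_norm_ge0.
  have h3 : nrm (z - z0) `^ r <= (nrm (z - u) + nrm (u - z0)) `^ r.
    by rewrite ge0_ler_powR// nnegrE is_norm_ge0.
  have := hC _ t0; rewrite powRr1// => h4.
  have := cp _ _ Zz Zu; rewrite pE powRr1 ?is_norm_ge0// => h5.
  have h6 : g * nrm (z - z0) `^ r <= g * (nrm (z - u) + nrm (u - z0)) `^ r.
    by rewrite ler_wpM2l// ltW.
  have h7 : lam * nrm (z - u) <= lam * c z u by rewrite ler_wpM2l// ltW.
  by move: h h4; rewrite !mulrDr mulr1; lra.
(* A subgradient of [- l k x] at [u] is an affine majorant of [l k x]. *)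
have [w hw] := convex_subgradient u (reg_concave hreg k x).
have [kap kap0 hkap] := is_norm_ge nrmP.
set W := \sum_j `|w 0 j|.
have W0 : 0 <= W by rewrite sumr_ge0.
have [C hC] : exists C, forall t, 0 <= t -> W / kap * t `^ 1 <= C + lam * t `^ p.
  apply: powR_dominated => //; first by rewrite ler01 lt_neqAle eq_sym pN1.
  by rewrite divr_ge0// ltW.
exists (l k x u + C) => z Zz.
have := hw z; have := le_dot_norm w (z - u); rewrite ler_norml -/W => /andP[h1 _] h2.
have h3 : W * `|z - u| <= W / kap * nrm (z - u).
  by rewrite -mulrA ler_wpM2l// mulrC ler_pdivlMr// mulrC.
have := hC _ (is_norm_ge0 nrmP (z - u)); rewrite powRr1 ?is_norm_ge0// => h4.
have h5 : lam * nrm (z - u) `^ p <= lam * c z u.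
  by rewrite ler_wpM2l ?cp// ltW.
by lra.
Qed.

Lemma cost_coercive u b : Z u ->
  exists M, forall z, Z z -> c z u <= b -> `|z| <= M.
Proof.
move=> Zu; have [nrm [p [nrmP p1 cp _]]] := reg_growth hreg.
have [kap kap0 hkap] := is_norm_ge nrmP.
exists (Num.max 1 b / kap + `|u|) => z Zz czb.
have nb : nrm (z - u) <= Num.max 1 b.
  (* A norm above 1 is at most its own [p]-th power, which the cost bounds. *)
  rewrite le_max; have [//|n1] := leP (nrm (z - u)) 1.
  apply: le_trans (le_trans (cp _ _ Zz Zu) czb).
  by rewrite le1r_powR// ltW.
have : `|z - u| <= Num.max 1 b / kap.
  by rewrite ler_pdivlMr// mulrC (le_trans (hkap _)).
by have := ler_normD (z - u) u; rewrite subrK; lra.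
Qed.

End regular.
End growth.

(** * Integrals without measurability and discrete integrals *)

Section integration.
Context {R : realType}.
Local Open Scope ereal_scope.

Section transfer.
Context (d1 d2 : measure_display).
Context (T1 : measurableType d1) (T2 : measurableType d2).
Variables (mu : {measure set T1 -> \bar R}) (nu : {measure set T2 -> \bar R}).
Variable phi : T1 -> T2.
Hypothesis mphi : measurable_fun setT phi.
Hypothesis mu_phi : forall A, measurable A -> mu (phi @^-1` A) = nu A.

(** Used with [phi] a coordinate projection and [mu] a coupling, to move integrals between the
    coupling and its marginals. *)
Lemma ge0_integral_image (f : T2 -> \bar R) : measurable_fun setT f ->
  (forall y, 0 <= f y) -> \int[nu]_y f y = \int[mu]_x f (phi x).
Proof.
move=> mf f0.
rewrite -(ge0_integral_pushforward mphi mu measurableT mf); last by move=> y _; exact: f0.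
apply: (eq_measure_integral
  (measure_function_pushforward__canonical__measure_function_Measure mu mphi)).
by move=> A mA _; rewrite /= /pushforward mu_phi.
Qed.
End transfer.

Section no_measurability.
Context (d : measure_display) (T : measurableType d).
Variable mu : {measure set T -> \bar R}.

(* The integral of a nonnegative function is a supremum over simple functions,
   so the larger function need not be measurable. *)
Lemma ge0_le_integral_patch (D E : set T) (f g : T -> \bar R) :
  (forall x, D x -> 0 <= f x) -> (forall x, E x -> 0 <= g x) ->
  D `<=` E -> (forall x, D x -> f x <= g x) ->
  \int[mu]_(x in D) f x <= \int[mu]_(x in E) g x.
Proof.
move=> f0 g0 DE fg; rewrite !ge0_integralE//.
apply: ereal_sup_le => _ [h /= hf <-]; exists h => //= x.
apply: le_trans (hf x) _; rewrite !patchE.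
case: ifPn => [/set_mem Dx|_]; first by rewrite mem_set ?fg//; exact: DE.
by case: ifPn => // /set_mem /g0.
Qed.
End no_measurability.

Section discrete.
Context (d : measure_display) (T : measurableType d).
Context (I : finType) (w : I -> R) (p : I -> T).
Hypotheses (w0 : forall i, (0 <= w i)%R) (w1 : (\sum_i w i = 1)%R).
Local Notation mu := (discrete_probability p w0 w1).

Let atom (i : 'I_#|I|) : {measure set T -> \bar R} :=
  mscale (NngNum (w0 (enum_val i))) (dirac (p (enum_val i))).

(** The finite family is listed as a sequence of measures, zero past [#|I|], so that the discrete
    measure becomes an [msum]. *)
Let atoms (j : nat) : {measure set T -> \bar R} :=
  if insub j is Some i then atom i else mzero.

Let atomsE (i : 'I_#|I|) : atoms i = atom i.
Proof. by rewrite /atoms valK. Qed.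

Lemma ge0_integral_discrete (f : T -> \bar R) : measurable_fun setT f ->
  (forall x, 0 <= f x) -> \int[mu]_x f x = \sum_i (w i)%:E * f (p i).
Proof.
move=> mf f0.
rewrite (eq_measure_integral (msum atoms #|I|)) => [|A mA _]; last first.
  rewrite /= /discrete_probability /msum (big_enum_val (A := I))/=.
  rewrite [LHS](_ : _ = \sum_(i < #|I|) (w (enum_val i))%:E * dirac (p (enum_val i)) A).
    by apply: eq_bigr => i _; rewrite atomsE.
  by [].
rewrite ge0_integral_measure_sum// [RHS](big_enum_val (A := I))/=.
apply: eq_bigr => i _; rewrite atomsE ge0_integral_mscale//=.
by rewrite integral_dirac// diracT mul1e.
Qed.

Import HBNNSimple.

(** Each simple function below [f] has its integral given by the finite sum, so [f] may be
    nonmeasurable. This is how the cost is integrated. *)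
Lemma ge0_integral_discrete_le (D : set T) (f : T -> \bar R) :
  (forall i, D (p i)) -> (forall x, D x -> 0 <= f x) ->
  \int[mu]_(x in D) f x <= \sum_i (w i)%:E * f (p i).
Proof.
move=> Dp f0; rewrite ge0_integralE//; apply: ge_ereal_sup => _ [h /= hf <-].
rewrite -integralT_nnsfun ge0_integral_discrete//=.
- apply: lee_sum => i _; rewrite lee_wpmul2l ?lee_fin ?w0//.
  by have := hf (p i); rewrite patchE mem_set.
- exact/measurable_EFinP/measurable_funP.
- by move=> x; rewrite lee_fin fun_ge0.
Qed.

Lemma integral_discrete (f : T -> R) : measurable_fun setT f ->
  \int[mu]_x (f x)%:E = (\sum_i w i * f (p i))%R%:E.
Proof.
move=> mf.
have mF : measurable_fun setT (EFin \o f) by exact/measurable_EFinP.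
rewrite integralE !ge0_integral_discrete//; first last.
- exact: measurable_funepos.
- exact: measurable_funeneg.
rewrite [X in X - _](eq_bigr (fun i => (w i * Num.max (f (p i)) 0)%:E)); last first.
  by move=> i _; rewrite funeposE EFinM/= EFin_max.
rewrite [X in _ - X](eq_bigr (fun i => (w i * Num.max (- f (p i)) 0)%:E)); last first.
  by move=> i _; rewrite funenegE EFinM/= EFin_max.
rewrite !sumEFin -EFinB -sumrB; congr EFin; apply: eq_bigr => i _.
by rewrite -mulrBr; congr (_ * _)%R; case: (leP (f (p i)) 0%R); case: (leP (- f (p i))%R 0%R); lra.
Qed.

End discrete.

End integration.

(** * Weak duality *)

Section borel.
Context {R : realType} (m : nat).

Lemma closed_measurable_borel (A : set 'rV[R]_m) :
  closed A -> measurable (A : set (borel R m)).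
Proof.
move=> cA; rewrite -(setCK A); apply: measurableC.
by apply: sub_sigma_algebra; exact: closed_openC.
Qed.

Lemma measurable_borel_set1 (a : 'rV[R]_m) : measurable ([set a] : set (borel R m)).
Proof.
apply: closed_measurable_borel; apply: accessible_closed_set1.
by apply: hausdorff_accessible; exact: norm_hausdorff.
Qed.

Lemma lsc_measurable_borel (f : 'rV[R]_m -> R) :
  (forall x0 e, 0 < e -> \forall x \near x0, f x0 - e < f x) ->
  measurable_fun setT (f : borel R m -> R).
Proof.
move=> hf; apply: (measurability _ (RGenOInfty.measurableE R)).
move=> _ [_ [a ->]] <-; rewrite setTI preimage_itvoy.
suff oA : @open 'rV[R]_m [set x | a < f x] by exact: sub_sigma_algebra.
rewrite openE => x /= afx.
have afx0 : 0 < f x - a by rewrite subr_gt0.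
by have := hf x _ afx0; rewrite opprB addrC subrK.
Qed.

End borel.

(** * Measurability and finiteness of the loss *)

Section loss.
Context {R : realType} (n m K : nat).
Variable (l : 'I_K -> 'rV[R]_n -> 'rV[R]_m -> R).
Hypothesis K0 : (0 < K)%N.
Hypothesis l_concave : forall k x, convex_function setT (fun z => - l k x z).

Lemma measurable_l k x : measurable_fun setT (l k x : borel R m -> R).
Proof.
rewrite (_ : l k x = fun z => - - l k x z); last by apply/funext => z; rewrite opprK.
apply: measurable_funN; apply: (@lsc_measurable_borel _ _ (fun z => - l k x z)).
by move=> z e; exact: convex_lower_semicontinuous.
Qed.

Lemma measurable_loss x : measurable_fun setT (loss l x : borel R m -> \bar R).
Proof.
rewrite /loss; elim: (index_enum _) => [|k s IH].
  rewrite (_ : (fun _ => _) = cst -oo%E); first exact: measurable_cst.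
  by apply/funext => z; rewrite big_nil.
rewrite (_ : (fun _ => _) = fun z => maxe (l k x z)%:E
    (\big[maxe/-oo%E]_(j <- s) (l j x z)%:E)); last first.
  by apply/funext => z; rewrite big_cons.
apply: measurable_maxe; last exact: IH.
exact: (measurable_EFinP setT (l k x : borel R m -> R)).2 (measurable_l k x).
Qed.

Lemma loss_le x z (a : R) : (forall k, l k x z <= a) -> (loss l x z <= a%:E)%E.
Proof. by move=> h; apply: bigmax_le => [|k _]; rewrite ?leNye ?lee_fin. Qed.

Lemma loss_fin_num x z : loss l x z \is a fin_num.
Proof.
rewrite fin_numElt; apply/andP; split.
  exact: lt_le_trans (ltNyr _) (le_loss l (Ordinal K0) x z).
apply: (@le_lt_trans _ _ (\sum_k `|l k x z|)%:E); last exact: ltry.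
apply: loss_le => k; rewrite (bigD1 k)//= (le_trans (ler_norm _))// lerDl.
by rewrite sumr_ge0.
Qed.

Lemma le_fine_loss k x z : l k x z <= fine (loss l x z).
Proof. by rewrite -lee_fin fineK ?loss_fin_num ?le_loss. Qed.

Lemma fine_loss_le x z (a : R) : (forall k, l k x z <= a) ->
  fine (loss l x z) <= a.
Proof. by move=> h; rewrite -lee_fin fineK ?loss_fin_num ?loss_le. Qed.

Lemma measurable_fine_loss x :
  measurable_fun setT ((fun z => fine (loss l x z)) : borel R m -> R).
Proof.
apply/measurable_EFinP; rewrite (_ : _ \o _ = loss l x).
  exact: measurable_loss.
by apply/funext => z /=; rewrite fineK ?loss_fin_num.
Qed.

Lemma expected_lossE Q x :
  expected_loss l Q x = (\int[Q]_z (fine (loss l x z))%:E)%E.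
Proof. by apply: eq_integral => z _; rewrite fineK ?loss_fin_num. Qed.

End loss.

Lemma maxr0B (R : realDomainType) (a : R) : Num.max a 0 - Num.max (- a) 0 = a.
Proof. by case: (leP a 0); case: (leP (- a) 0); lra. Qed.

(** The inequality [a <= b + t] with nonnegative terms only, so that it can be integrated before any
    integral is known to be finite. *)
Lemma maxr0_split (R : realDomainType) (a b t : R) : a - b <= t ->
  Num.max a 0 + Num.max (- b) 0 <= Num.max (- a) 0 + (Num.max b 0 + t).
Proof. by have := maxr0B a; have := maxr0B b; lra. Qed.

Section weak_duality.
Context {R : realType} (n m N K : nat) (N0 : (0 < N)%N).
Variables (X : set 'rV[R]_n) (Z : set 'rV[R]_m).
Variables (c : 'rV[R]_m -> 'rV[R]_m -> R).
Variables (l : 'I_K -> 'rV[R]_n -> 'rV[R]_m -> R).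
Variables (zhat : 'I_N -> 'rV[R]_m) (rho : R).
Hypotheses (hc : transport_cost Z c) (hzhat : forall i, Z (zhat i)).
Hypotheses (K0 : (0 < K)%N) (l_concave : forall k x, convex_function setT (fun z => - l k x z)).

(** The coupling [gamma] ships the mass [alpha_ik / N] from the atom [zhat_i + v_ik] to [zhat_i];
    its cost is bounded by the budget constraint. *)
Lemma dual_distribution_in_ambiguity_set (s : variables R n m N K)
    (fs : program_feasible Z c zhat rho s) :
  ambiguity_set Z c N0 zhat rho (dual_distribution N0 fs).
Proof.
split.
  rewrite -[RHS]/(1%R%:E) -[X in X%:E](dual_weights_sum N0 fs) -sumEFin.
  apply: eq_bigr => ik _; rewrite diracE mem_set ?mule1//.
  exact: (atom_in fs).
pose q (ik : 'I_N * 'I_K) : (borel R m * borel R m)%type :=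
  (zhat ik.1 + v s ik.1 ik.2, zhat ik.1).
pose gamma : probability (borel R m * borel R m)%type R :=
  discrete_probability q (dual_weights_ge0 fs) (dual_weights_sum N0 fs).
apply: (@le_trans _ _ (\int[gamma]_(w in Z `*` Z) (c w.1 w.2)%:E)%E).
  apply: ereal_inf_lbound; exists gamma => //; split => A mA.
    apply: eq_bigr => ik _; congr (_ * _)%E; rewrite !diracE.
    by rewrite in_setX in_setT andbT.
  rewrite /= /discrete_probability.
  rewrite -(pair_bigA _ (fun i k => (N%:R^-1 * alpha s i k)%:E * dirac (q (i, k)) (setT `*` A)))%E/=.
  apply: eq_bigr => i _.
  have NE : N%:R^-1 = \sum_k N%:R^-1 * alpha s i k.
    by rewrite -mulr_sumr (alpha_sum fs) mulr1.
  rewrite [in RHS]NE -sumEFin ge0_sume_distrl => [|k _]; last first.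
    by rewrite lee_fin mulr_ge0 ?invr_ge0// (alpha_ge0 fs).
  by apply: eq_bigr => k _; congr (_ * _)%E; rewrite !diracE in_setX in_setT.
apply: le_trans (ge0_integral_discrete_le _ _ _ _) _ => //=.
- by move=> ik; split => /=; [exact: (atom_in fs)|exact: hzhat].
- by move=> w [Z1 Z2]; rewrite lee_fin (cost_ge0 hc).
rewrite -(pair_bigA _ (fun i k => (N%:R^-1 * alpha s i k)%:E *
  (c (zhat i + v s i k)%R (zhat i))%:E))%E/=.
under eq_bigr do under eq_bigr do rewrite -EFinM.
under eq_bigr do rewrite sumEFin.
rewrite sumEFin lee_fin; apply: le_trans (budget fs).
rewrite mulr_sumr ler_sum// => i _; rewrite mulr_sumr ler_sum// => k _.
by rewrite mulrA.
Qed.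

(** Fenchel-Young at a fixed [x]: conjugates and support function are bounded below by their values
    at [x], and stationarity cancels all linear terms. *)
Lemma program_objective_le_dual (s : variables R n m N K)
    (fs : program_feasible Z c zhat rho s) :
  (program_objective X l zhat s <=
   dual_DRO_objective l X (dual_distribution N0 fs))%E.
Proof.
apply: le_ereal_inf_tmp => _ [x Xx <-].
rewrite expected_lossE// integral_discrete; last exact: measurable_fine_loss.
rewrite -(pair_bigA _ (fun i k => N%:R^-1 * alpha s i k *
  fine (loss l x (zhat i + v s i k))))/=.
set B := (X in (_ <= X%:E)%E).
have conj_ge i k : ((alpha s i k * (dot (y s i k) x - l k x (zhat i + v s i k)))%:E <=
    (alpha s i k)%:E * conjugate1 (l k) (y s i k) (zhat i + v s i k)%R)%E.
  rewrite EFinM lee_wpmul2l ?lee_fin ?(alpha_ge0 fs)//.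
  by apply: ereal_sup_ubound; exists x.
have supp_ge : ((nu s * dot (theta s) x)%:E <= (nu s)%:E * support_function X (theta s))%E.
  rewrite EFinM lee_wpmul2l ?lee_fin ?(nu_ge0 fs)//.
  by apply: ereal_sup_ubound; exists x.
pose S := N%:R^-1 * \sum_i \sum_k
  alpha s i k * (dot (y s i k) x - l k x (zhat i + v s i k)).
apply: (@le_trans _ _ (- S - nu s * dot (theta s) x)%:E).
  rewrite EFinB; apply: leeB => //; rewrite EFinN leeN2 EFinM.
  rewrite lee_wpmul2l ?lee_fin ?invr_ge0// -sumEFin; apply: lee_sum => i _.
  by rewrite -sumEFin; apply: lee_sum => k _.
have := congr1 (fun t => dot t x) (stationarity fs).
rewrite /= dot0l dotDl !dotZl dot_suml => st.
have -> : - S - nu s * dot (theta s) x =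
    N%:R^-1 * \sum_i \sum_k alpha s i k * l k x (zhat i + v s i k).
  move: st; rewrite (eq_bigr (fun i => \sum_k dot (alpha s i k *: y s i k) x));
    last by move=> i _; rewrite dot_suml.
  rewrite /S; have -> : \sum_i \sum_k alpha s i k * (dot (y s i k) x - l k x (zhat i + v s i k)) =
     \sum_i \sum_k dot (alpha s i k *: y s i k) x -
     \sum_i \sum_k alpha s i k * l k x (zhat i + v s i k).
    rewrite -sumrB; apply: eq_bigr => i _; rewrite -sumrB; apply: eq_bigr => k _.
    by rewrite dotZl; ring.
  by rewrite mulrBr; lra.
rewrite lee_fin /B mulr_sumr ler_sum// => i _; rewrite mulr_sumr ler_sum// => k _.
rewrite -mulrA ler_wpM2l ?invr_ge0// ler_wpM2l ?(alpha_ge0 fs)//.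
exact: le_fine_loss.
Qed.

(** Integrate [loss <= M + lam * c] against a nearly optimal coupling. Since [c] and [M] may be
    nonmeasurable and the loss nonintegrable, measurable substitutes and positive and negative parts
    are used. *)
Lemma expected_loss_le_lagrangian Q x lam (M : 'rV[R]_m -> R) :
  closed Z -> ambiguity_set Z c N0 zhat rho Q -> 0 < lam ->
  (forall i k z, Z z -> l k x z <= M (zhat i) + lam * c z (zhat i)) ->
  (expected_loss l Q x <= (lam * rho + N%:R^-1 * \sum_i M (zhat i))%:E)%E.
Proof.
move=> cZ [QZ OTQ] lam0 hM; apply/lee_addgt0Pr => e e0.
have : (OT Z c Q (empirical N0 zhat) < (rho + e / lam)%:E)%E.
  by apply: le_lt_trans OTQ _; rewrite lte_fin ltrDl divr_gt0.
case/ereal_inf_lt => _ [gamma [gamma1 gamma2] <-] costgamma.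
pose L (z : borel R m) : R := fine (loss l x z).
have mL : measurable_fun setT L by exact: measurable_fine_loss.
(* A measurable function that agrees with [M] on the finitely many [zhat i], the support of the
   second marginal. *)
pose Mt (u : borel R m) : R :=
  \sum_(v <- undup (codom zhat)) M v * \1_([set v] : set (borel R m)) u.
have mMt : measurable_fun setT Mt.
  apply: measurable_sum => v; apply: measurable_funM => //.
  by apply: measurable_indic; exact: measurable_borel_set1.
have MtE i : Mt (zhat i) = M (zhat i).
  rewrite /Mt (bigD1_seq (zhat i)) ?undup_uniq ?mem_undup ?codom_f//=.
  rewrite indicE mem_set// mulr1 big1 ?addr0// => v vi.
  by rewrite indicE memNset ?mulr0// => zv; rewrite zv eqxx in vi.
(* A measurable minorant of the cost off the null set [NN] below. *)
pose g (w : borel R m * borel R m) : R := Num.max 0 (L w.1 - Mt w.2) / lam.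
have g0 w : 0 <= g w by rewrite divr_ge0 ?(ltW lam0)// le_max lexx.
have mL1 : measurable_fun setT (fun w : borel R m * borel R m => L w.1).
  exact: (measurableT_comp mL measurable_fst).
have mM2 : measurable_fun setT (fun w : borel R m * borel R m => Mt w.2).
  exact: (measurableT_comp mMt measurable_snd).
have mg : measurable_fun setT g.
  apply: measurable_funM => //; apply: measurable_maxr => //.
  exact: measurable_funB.
pose U : set (borel R m) := \bigcup_(i in [set: 'I_N]) [set zhat i].
have mU : measurable U.
  by apply: fin_bigcup_measurable => // i _; exact: measurable_borel_set1.
have mZ : measurable (Z : set (borel R m)) by exact: closed_measurable_borel.
pose NN : set (borel R m * borel R m) := ((~` Z) `*` setT) `|` (setT `*` (~` U)).
have mNN1 : measurable ((~` Z : set (borel R m)) `*` (setT : set (borel R m))).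
  by apply: measurableX => //; exact: measurableC.
have mNN2 : measurable ((setT : set (borel R m)) `*` (~` U)).
  by apply: measurableX => //; exact: measurableC.
have mNN : measurable NN by exact: measurableU.
have gammaZ : gamma ((~` Z) `*` setT) = 0%E.
  rewrite gamma1; last exact: measurableC.
  by rewrite probability_setC// QZ subee.
have gammaU : gamma (setT `*` (~` U)) = 0%E.
  rewrite gamma2; last exact: measurableC.
  rewrite /= /discrete_probability big1// => i _.
  by rewrite diracE memNset ?mule0// => /(_ _); apply; exists i.
have NN0 : gamma NN = 0%E.
  apply/eqP; rewrite eq_le measure_ge0 andbT.
  apply: le_trans (measureU2 gamma mNN1 mNN2) _.
  rewrite -[leRHS]adde0; apply: leeD; rewrite le_eqVlt; apply/orP; left; apply/eqP.
    exact: gammaZ.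
  exact: gammaU.
have Ig : (\int[gamma]_w (g w)%:E <= (rho + e / lam)%:E)%E.
  rewrite (ge0_negligible_integral mNN)//; last 2 first.
  - exact/measurable_EFinP.
  - by move=> w _; rewrite lee_fin.
  apply: le_trans (ltW costgamma); apply: ge0_le_integral_patch => [w _|w [? ?]|w|w].
  - by rewrite lee_fin.
  - by rewrite lee_fin (cost_ge0 hc).
  - move=> [_ /not_orP[h1 h2]]; split.
      by apply: contra_notP h1 => ?; split.
    have : U w.2 by apply: contra_notP h2 => ?; split.
    by case=> i _ ->.
  move=> [_ /not_orP[h1 h2]].
  have Zw : Z w.1 by apply: contra_notP h1 => ?; split.
  have [i _ wi] : U w.2 by apply: contra_notP h2 => ?; split.
  rewrite lee_fin ler_pdivrMr// ge_max mulr_ge0 ?(cost_ge0 hc) ?(ltW lam0)//=; last first.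
    by rewrite wi.
  rewrite lerBlDl wi MtE mulrC; apply: fine_loss_le => [//|k].
  exact: hM.
have marg1 (f : borel R m -> R) : measurable_fun setT f -> (forall z, 0 <= f z) ->
    (\int[Q]_z (f z)%:E = \int[gamma]_w (f w.1)%:E)%E.
  move=> mf f0.
  apply: (@ge0_integral_image _ _ _ _ _ gamma Q fst _ _ (EFin \o f)) => //.
  - move=> A mA; rewrite (_ : _ @^-1` A = A `*` setT); first exact: gamma1.
    by apply/seteqP; split => w /=; rewrite /setX/=; tauto.
  - exact/measurable_EFinP.
have marg2 (f : borel R m -> R) : measurable_fun setT f -> (forall z, 0 <= f z) ->
    ((\sum_i N%:R^-1 * f (zhat i))%:E = \int[gamma]_w (f w.2)%:E)%E.
  move=> mf f0; rewrite -(integral_discrete (zhat : 'I_N -> borel R m) (@uniform_weights_ge0 R N)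
    (uniform_weights_sum R N0) mf).
  apply: (@ge0_integral_image _ _ _ _ _ gamma (empirical N0 zhat) snd _ _ (EFin \o f)) => //.
  - move=> A mA; rewrite (_ : _ @^-1` A = setT `*` A); first exact: gamma2.
    by apply/seteqP; split => w /=; rewrite /setX/=; tauto.
  - exact/measurable_EFinP.
pose pos (f : borel R m -> R) z := Num.max (f z) 0.
have pos0 f z : 0 <= pos f z by rewrite le_max lexx orbT.
have mpos f : measurable_fun setT f -> measurable_fun setT (pos f).
  by move=> mf; exact: measurable_maxr.
pose Ln (z : borel R m) := - L z; pose Mn (z : borel R m) := - Mt z.
have mLn : measurable_fun setT Ln by exact: measurable_funN.
have mMn : measurable_fun setT Mn by exact: measurable_funN.
have mfst f : measurable_fun setT f ->
    measurable_fun setT (fun w : borel R m * borel R m => (pos f w.1)%:E).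
  move=> mf; apply/measurable_EFinP.
  exact: (measurableT_comp (mpos _ mf) measurable_fst).
have msnd f : measurable_fun setT f ->
    measurable_fun setT (fun w : borel R m * borel R m => (pos f w.2)%:E).
  move=> mf; apply/measurable_EFinP.
  exact: (measurableT_comp (mpos _ mf) measurable_snd).
have mlg : measurable_fun setT (fun w => lam%:E * (g w)%:E)%E.
  by apply: emeasurable_funM => //; exact/measurable_EFinP.
have lg0 w : (0 <= lam%:E * (g w)%:E)%E by rewrite mule_ge0 ?lee_fin ?(ltW lam0).
have key : (\int[gamma]_w ((pos L w.1)%:E + (pos Mn w.2)%:E) <=
    \int[gamma]_w ((pos Ln w.1)%:E + ((pos Mt w.2)%:E + lam%:E * (g w)%:E)))%E.
  apply: ge0_le_integral => //.
  - by move=> w _; rewrite adde_ge0// lee_fin.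
  - by apply: emeasurable_funD; [exact: mfst|exact: msnd].
  - apply: emeasurable_funD; first exact: mfst.
    by apply: emeasurable_funD => //; exact: msnd.
  - move=> w _; rewrite -EFinM -!EFinD lee_fin /pos /Ln /Mn.
    have -> : lam * g w = Num.max 0 (L w.1 - Mt w.2) by rewrite /g mulrC divfK ?gt_eqF.
    by apply: maxr0_split; rewrite le_max lexx orbT.
have EE : expected_loss l Q x = (\int[Q]_z (pos L z)%:E - \int[Q]_z (pos Ln z)%:E)%E.
  rewrite expected_lossE// integralE; congr (_ - _)%E; apply: eq_integral => z _.
    by rewrite funeposE /= EFin_max.
  by rewrite funenegE /= EFin_max.
move: key; rewrite ge0_integralD//; [|by move=> w _; rewrite lee_fin|exact: mfst|
  by move=> w _; rewrite lee_fin|exact: msnd].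
rewrite ge0_integralD//; [|by move=> w _; rewrite lee_fin|exact: mfst|
  by move=> w _; apply: adde_ge0 => //; rewrite lee_fin|
  by apply: emeasurable_funD => //; exact: msnd].
rewrite ge0_integralD//; [|by move=> w _; rewrite lee_fin|exact: msnd].
rewrite ge0_integralZl_EFin//; [|by move=> w _; rewrite lee_fin|
  by apply/measurable_EFinP|by rewrite ltW].
rewrite -(marg2 (pos Mn))//; last exact: mpos.
rewrite -(marg2 (pos Mt))//; last exact: mpos.
rewrite -(marg1 (pos L))//; last exact: mpos.
rewrite -(marg1 (pos Ln))//; last exact: mpos.
rewrite EE.
have : (0 <= \int[Q]_z (pos L z)%:E)%E.
  by apply: integral_ge0 => z _; rewrite lee_fin.
have : (0 <= \int[Q]_z (pos Ln z)%:E)%E.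
  by apply: integral_ge0 => z _; rewrite lee_fin.
have : (0 <= \int[gamma]_w (g w)%:E)%E.
  by apply: integral_ge0 => w _; rewrite lee_fin.
move: Ig (\int[Q]_z (pos L z)%:E)%E (\int[Q]_z (pos Ln z)%:E)%E.
case: (\int[gamma]_w (g w)%:E)%E => // gi; rewrite lee_fin => gi1 a b _.
have -> : N%:R^-1 * \sum_i M (zhat i) =
    \sum_i N%:R^-1 * pos Mt (zhat i) - \sum_i N%:R^-1 * pos Mn (zhat i).
  rewrite mulr_sumr -sumrB; apply: eq_bigr => i _; rewrite -mulrBr /pos /Mn MtE.
  by rewrite maxr0B.
have lgi : lam * gi <= lam * rho + e.
  by rewrite -ler_pdivlMl// mulrDr mulKf ?gt_eqF// mulrC.
(* Here [a] and [b] are the integrals of the positive and negative parts. If [b] is infinite the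
   difference is [-oo], even when [a] is infinite; if only [a] is, the integrated inequality
   fails. *)
clear -gi1 lgi; case: b => [b| |] // _; case: a => [a| |] // _; rewrite -?EFinM -?EFinD ?lee_fin//.
- by lra.
- by rewrite leNye.
- by rewrite leNye.
Qed.

End weak_duality.

(** * Minimax over finitely many decisions *)

Section alternative.
Context {R : realType}.

Definition convex_graph (I : Type) (E : (I -> R) -> set R) := forall u v a b t,
  E u a -> E v b -> 0 <= t <= 1 ->
  E (fun i => t * u i + (1 - t) * v i) (t * a + (1 - t) * b).

(** The lower boundary [inf (E u)] is a convex function of [u], and a subgradient at 0 gives the
    supporting hyperplane. *)
Lemma convex_graph_support (I : finType) (E : (I -> R) -> set R) b :
  (forall u, E u !=set0) -> lbound (E (fun=> 0)) b -> convex_graph E ->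
  exists w : I -> R, forall u t, E u t -> b + \sum_i w i * u i <= t.
Proof.
move=> E0 lbE cE.
(* The midpoint of a point over [u] and a point over [- u] lies over 0, hence above [b]. *)
have lb u : has_lbound (E u).
  have [s Es] := E0 (fun i => - u i); exists (2 * b - s) => t Et.
  have h01 : 0 <= (2^-1 : R) <= 1 by rewrite invr_ge0 ler0n invf_le1 ?ltr0n// ler1n.
  have := cE _ _ _ _ _ Et Es h01.
  rewrite (_ : (fun _ => _) = (fun=> 0)); last by apply/funext => i; field.
  by move=> /lbE; lra.
pose p u := inf (E u).
have cp : convex_fct p.
  move=> u v t t01; have /andP[t0 t1] := t01.
  apply/ler_addgt0Pr => e e0.
  have [a Ea ha] := inf_adherent e0 (conj (E0 u) (lb u)).
  have [a' Ea' ha'] := inf_adherent e0 (conj (E0 v) (lb v)).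
  have : p (fun i => t * u i + (1 - t) * v i) <= t * a + (1 - t) * a'.
    by apply: ge_inf => //; exact: cE.
  move=> /le_trans; apply.
  have : t * a <= t * (p u + e) by rewrite ler_wpM2l// ltW.
  have : (1 - t) * a' <= (1 - t) * (p v + e) by rewrite ler_wpM2l ?subr_ge0// ltW.
  by rewrite !mulrDr; lra.
have [w hw] := subgradient cp; exists w => u t Et.
apply: (@le_trans _ _ (p u)); last exact: ge_inf.
apply: le_trans (hw u); rewrite lerD2r; exact: lb_le_inf.
Qed.

(** A theorem of the alternative by separation: [E u] collects the slacks [a] for which some [s]
    satisfies [u - a <= h s], and over 0 no slack is below [e]. *)
Lemma concavelike_alternative (T : Type) (S : set T) (I : finType)
    (h : T -> I -> R) e : S !=set0 ->
  (forall s1 s2 t, S s1 -> S s2 -> 0 <= t <= 1 ->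
     exists2 s, S s & forall i, t * h s1 i + (1 - t) * h s2 i <= h s i) ->
  (forall s, S s -> exists i, h s i < - e) ->
  exists2 w : I -> R, (forall i, 0 <= w i) &
    forall s, S s -> \sum_i w i * h s i <= - e.
Proof.
move=> [s0 Ss0] hS hN.
pose E (u : I -> R) : set R := [set a | exists2 s, S s & forall i, u i - h s i <= a].
have [|||w hw] := @convex_graph_support I E e.
- move=> u; exists (\sum_i `|u i - h s0 i|), s0 => // i.
  by rewrite (bigD1 i)//= (le_trans (ler_norm _))// lerDl sumr_ge0.
- move=> a [s Ss hs]; have [i hi] := hN _ Ss; have := hs i.
  by rewrite sub0r; lra.
- move=> u v a b t [s1 Ss1 hs1] [s2 Ss2 hs2] t01.
  have [s Ss hs] := hS _ _ _ Ss1 Ss2 t01; exists s => // i.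
  move/andP: t01 => [t0 t1]; have := hs i.
  have : t * (u i - h s1 i) <= t * a by rewrite ler_wpM2l.
  have : (1 - t) * (v i - h s2 i) <= (1 - t) * b by rewrite ler_wpM2l ?subr_ge0.
  by rewrite !mulrBr; lra.
exists w => [i|s Ss]; last first.
  have : E (h s) 0 by exists s => // i; rewrite subrr.
  by move/hw; lra.
rewrite leNgt; apply/negP => wi.
(* Were [w i] negative, lowering [u i] to [B / w i] would keep the slack [A] admissible while the
   linear bound rises to [e + B], which exceeds [A]. *)
pose A := \sum_j `|h s0 j|; pose B := `|A| + `|e| + 1.
have B0 : 0 < B by rewrite /B ltr_wpDl// addr_ge0.
pose u j := if j == i then B / w i else 0.
have Eu : E u A.
  exists s0 => // j; rewrite /u.
  have hA : - h s0 j <= A.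
    by rewrite /A (bigD1 j)//= -normrN (le_trans (ler_norm _))// lerDl sumr_ge0.
  case: eqP => _; last by rewrite sub0r.
  by apply: le_trans hA; rewrite gerDr nmulr_lle0 ?invr_lt0// ltW.
have := hw _ _ Eu; rewrite (bigD1 i)//= big1 => [|j /negbTE ji]; last first.
  by rewrite /u ji mulr0.
rewrite /u eqxx addr0 mulrC divfK ?lt_eqF// /B.
by have := ler_norm A; have := ler_norm (- e); rewrite normrN; lra.
Qed.

(** Unnormalized Jensen inequality. The point [x] does not depend on [f]: later the mixture defining
    [f] is chosen after [x]. *)
Lemma convex_combination (V : lmodType R) (X : set V) (J : Type) (xs : J -> V)
    (w : J -> R) (s : seq J) : convex_set X -> (forall j, X (xs j)) ->
  (forall j, 0 <= w j) -> 0 < \sum_(j <- s) w j ->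
  exists2 x, X x & forall f : V -> R,
    (forall x y t, 0 <= t <= 1 -> f (t *: x + (1 - t) *: y) <= t * f x + (1 - t) * f y) ->
    (\sum_(j <- s) w j) * f x <= \sum_(j <- s) w j * f (xs j).
Proof.
move=> /convex_setP cX Xxs w0; elim: s => [|j s IH]; first by rewrite big_nil ltxx.
rewrite big_cons => W0.
have : 0 <= \sum_(i <- s) w i by rewrite sumr_ge0.
rewrite le_eqVlt => /predU1P[/esym Ws|Ws].
  exists (xs j) => // f _; rewrite big_cons Ws addr0.
  suff -> : \sum_(i <- s) w i * f (xs i) = 0 by rewrite addr0.
  elim: s Ws {IH W0} => [|i s IH]; first by rewrite !big_nil.
  rewrite !big_cons => /eqP; rewrite paddr_eq0 ?sumr_ge0// => /andP[/eqP-> /eqP/IH->].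
  by rewrite mul0r addr0.
have [x Xx hx] := IH Ws.
set W := \sum_(i <- s) w i in W0 Ws hx *.
pose t := w j / (w j + W).
have t01 : 0 <= t <= 1.
  rewrite divr_ge0 ?(ltW W0)//= ler_pdivrMr// mul1r lerDl; exact: ltW.
exists (t *: xs j + (1 - t) *: x); first exact: cX.
move=> f cf; rewrite big_cons.
apply: (@le_trans _ _ ((w j + W) * (t * f (xs j) + (1 - t) * f x))).
  by rewrite ler_wpM2l ?cf// ltW.
have -> : (w j + W) * (t * f (xs j) + (1 - t) * f x) = w j * f (xs j) + W * f x.
  by rewrite /t; field; rewrite gt_eqF.
by rewrite lerD2l hx.
Qed.

End alternative.

(** * Mixtures of atoms, their payoff and their cost *)

Section mixtures.
Context {R : realType} (n m N K : nat).
Variables (X : set 'rV[R]_n) (Z : set 'rV[R]_m).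
Variables (c : 'rV[R]_m -> 'rV[R]_m -> R).
Variables (l : 'I_K -> 'rV[R]_n -> 'rV[R]_m -> R).
Variables (zhat : 'I_N -> 'rV[R]_m).

Definition mixture : Type := ('I_N -> 'I_K -> R) * ('I_N -> 'I_K -> 'rV[R]_m).

Definition is_mixture : set mixture := [set s |
  [/\ forall i k, 0 <= s.1 i k, forall i, \sum_k s.1 i k = 1 & forall i k, Z (s.2 i k)]].

Definition payoff (s : mixture) (x : 'rV[R]_n) : R :=
  N%:R^-1 * \sum_i \sum_k s.1 i k * l k x (s.2 i k).

Definition mixture_cost (s : mixture) : R :=
  N%:R^-1 * \sum_i \sum_k s.1 i k * c (s.2 i k) (zhat i).

Hypotheses (hc : transport_cost Z c) (hzhat : forall i, Z (zhat i)).
Hypotheses (Z_convex : convex_set Z).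
Hypotheses (l_convex : forall k z, convex_function setT (fun x => l k x z)).
Hypotheses (l_concave : forall k x, convex_function setT (fun z => - l k x z)).
Hypothesis K0 : (0 < K)%N.

Lemma mixture_cost_ge0 s : is_mixture s -> 0 <= mixture_cost s.
Proof.
move=> [s0 _ sZ]; rewrite mulr_ge0 ?invr_ge0// sumr_ge0// => i _.
by rewrite sumr_ge0// => k _; rewrite mulr_ge0// (cost_ge0 hc).
Qed.

Lemma payoff_convex s : is_mixture s -> forall x y t, 0 <= t <= 1 ->
  payoff s (t *: x + (1 - t) *: y) <= t * payoff s x + (1 - t) * payoff s y.
Proof.
move=> [s0 _ _] x y t t01.
rewrite /payoff !(mulrCA _ N%:R^-1) -mulrDr ler_wpM2l ?invr_ge0//.
rewrite !mulr_sumr -big_split ler_sum//= => i _.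
rewrite !mulr_sumr -big_split ler_sum//= => k _.
rewrite !(mulrCA _ (s.1 i k)) -mulrDr ler_wpM2l//.
exact: (convex_functionP (l_convex k (s.2 i k))).
Qed.

Definition selection (k : 'I_N -> 'I_K) (z : 'I_N -> 'rV[R]_m) : mixture :=
  (fun i j => (j == k i)%:R, fun i _ => z i).

Lemma selection_sum k (i : 'I_N) (f : 'I_K -> R) :
  \sum_j (j == k i)%:R * f j = f (k i).
Proof.
rewrite (bigD1 (k i))//= eqxx mul1r big1 ?addr0// => j /negbTE ->.
by rewrite mul0r.
Qed.

Lemma selection_mixture k z : (forall i, Z (z i)) -> is_mixture (selection k z).
Proof.
move=> Zz; split => //= i.
rewrite -[RHS](selection_sum k i (fun=> 1)).
by apply: eq_bigr => j _; rewrite mulr1.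
Qed.

Lemma payoff_selection k z x :
  payoff (selection k z) x = N%:R^-1 * \sum_i l (k i) x (z i).
Proof.
congr (_ * _); apply: eq_bigr => i _.
exact: (selection_sum k i (fun j => l j x (z i))).
Qed.

Lemma mixture_cost_selection k z :
  mixture_cost (selection k z) = N%:R^-1 * \sum_i c (z i) (zhat i).
Proof.
congr (_ * _); apply: eq_bigr => i _.
exact: (selection_sum k i (fun j => c (z i) (zhat i))).
Qed.

(** Joint convexity of the perspective of [f], in terms of moments. *)
Lemma perspective_le (f : 'rV[R]_m -> R) b1 b2 z1 z2 : convex_function Z f ->
  0 <= b1 -> 0 <= b2 -> 0 < b1 + b2 -> Z z1 -> Z z2 ->
  (b1 + b2) * f (b1 / (b1 + b2) *: z1 + (1 - b1 / (b1 + b2)) *: z2) <=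
  b1 * f z1 + b2 * f z2.
Proof.
move=> /convex_functionP cf b10 b20 b0 Zz1 Zz2.
have t01 : 0 <= b1 / (b1 + b2) <= 1.
  by rewrite divr_ge0 ?(ltW b0)//= ler_pdivrMr// mul1r lerDl.
apply: le_trans (ler_wpM2l (ltW b0) (cf _ _ _ Zz1 Zz2 t01)) _.
by rewrite le_eqVlt; apply/orP; left; apply/eqP; field; rewrite gt_eqF.
Qed.

(* Averaging two mixtures averages the moments [alpha * z], not the atoms. *)
Lemma mixture_concavelike s1 s2 t : is_mixture s1 -> is_mixture s2 -> 0 <= t <= 1 ->
  exists s, [/\ is_mixture s,
    forall x, t * payoff s1 x + (1 - t) * payoff s2 x <= payoff s x &
    mixture_cost s <= t * mixture_cost s1 + (1 - t) * mixture_cost s2].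
Proof.
move=> [a10 a11 Z1] [a20 a21 Z2] /andP[t0 t1].
have t1' : 0 <= 1 - t by rewrite subr_ge0.
pose b1 i k := t * s1.1 i k; pose b2 i k := (1 - t) * s2.1 i k.
have b10 i k : 0 <= b1 i k by rewrite mulr_ge0.
have b20 i k : 0 <= b2 i k by rewrite mulr_ge0.
pose r i k := b1 i k / (b1 i k + b2 i k).
(* An atom without mass has no barycenter; any point of [Z] serves. *)
pose z i k := if b1 i k + b2 i k == 0 then zhat i else
  r i k *: s1.2 i k + (1 - r i k) *: s2.2 i k.
have bgt0 i k : b1 i k + b2 i k != 0 -> 0 < b1 i k + b2 i k.
  by move=> b0; rewrite lt_neqAle eq_sym b0 addr_ge0.
have key i k f : convex_function Z f ->
    (b1 i k + b2 i k) * f (z i k) <= b1 i k * f (s1.2 i k) + b2 i k * f (s2.2 i k).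
  move=> cf; rewrite /z; case: eqP => [b0|/eqP b0].
    have /andP[/eqP-> /eqP->] : (b1 i k == 0) && (b2 i k == 0).
      by rewrite -paddr_eq0// b0.
    by rewrite addr0 !mul0r addr0.
  by apply: perspective_le => //; exact: bgt0.
exists (fun i k => b1 i k + b2 i k, z); split.
- split => /= [i k|i|i k].
  + exact: addr_ge0.
  + by rewrite /b1 /b2 big_split/= -!mulr_sumr a11 a21; ring.
  + rewrite /z; case: eqP => [//|/eqP b0].
    apply: (convex_setP Z_convex) => //.
    by rewrite divr_ge0 ?addr_ge0//= ler_pdivrMr ?bgt0// mul1r lerDl.
- move=> x; rewrite /payoff/= !(mulrCA _ N%:R^-1) -mulrDr ler_wpM2l ?invr_ge0//.
  rewrite !mulr_sumr -big_split ler_sum//= => i _.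
  rewrite !mulr_sumr -big_split ler_sum//= => k _.
  have cl : convex_function Z (fun z => - l k x z).
    by move=> r' u u' _ _; apply: l_concave; rewrite inE.
  have := key i k _ cl; rewrite !mulrN -opprD lerN2.
  by rewrite !mulrA.
- rewrite /mixture_cost/= !(mulrCA _ N%:R^-1) -mulrDr ler_wpM2l ?invr_ge0//.
  rewrite !mulr_sumr -big_split ler_sum//= => i _.
  rewrite !mulr_sumr -big_split ler_sum//= => k _.
  by have := key i k _ (cost_convex hc (hzhat i)); rewrite !mulrA.
Qed.

(* By convexity in [x], a separating weight on the constraints collapses to a
   single point of [X] and a multiplier [lam] of the budget. *)
Lemma minimax_finite rho b (J : nat) (xs : 'I_J -> 'rV[R]_n) e :
  0 < rho -> convex_set X -> (forall j, X (xs j)) -> 0 < e ->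
  (forall x lam d, X x -> 0 < lam -> 0 < d -> exists2 s, is_mixture s &
     b - d <= payoff s x + lam * (rho - mixture_cost s)) ->
  exists s, [/\ is_mixture s, mixture_cost s <= rho + e &
     forall j, b - e <= payoff s (xs j)].
Proof.
move=> rho0 cX Xxs e0 hb; apply: contrapT => nos.
pose h (s : mixture) (o : option 'I_J) :=
  if o is Some j then payoff s (xs j) - b else rho - mixture_cost s.
pose s0 := selection (fun=> Ordinal K0) zhat.
have ms0 : is_mixture s0 by exact: selection_mixture.
have [|||w w0 hw] := @concavelike_alternative _ _ is_mixture _ h e.
- by exists s0.
- move=> s1 s2 t ms1 ms2 t01.
  have [s [ms hs1 hs2]] := mixture_concavelike ms1 ms2 t01.
  exists s => // -[j|]; rewrite /h.
    by have := hs1 (xs j); rewrite !mulrBr; lra.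
  by move: hs2; rewrite !mulrBr; lra.
- move=> s ms; apply: contra_notP nos => hN; exists s; split => //.
    rewrite leNgt; apply/negP => lt; apply: hN; exists None; rewrite /h; lra.
  move=> j; rewrite leNgt; apply/negP => lt; apply: hN; exists (Some j); rewrite /h; lra.
have hw' s : is_mixture s ->
   w None * (rho - mixture_cost s) +
   \sum_j w (Some j) * (payoff s (xs j) - b) <= - e.
  move=> /hw; rewrite (bigD1 None)//=; apply: le_trans; rewrite lerD2l.
  rewrite [leRHS](reindex_omap Some id)//=; last by case.
  rewrite le_eqVlt; apply/orP; left; apply/eqP.
  by apply: eq_bigl => j; rewrite eqxx.
have : 0 <= \sum_j w (Some j) by rewrite sumr_ge0.
(* If no decision carries weight, the costless mixture [s0] contradicts the separation, because
   [rho > 0]. *)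
rewrite le_eqVlt => /predU1P[/esym W0|W0].
  have := hw' _ ms0; rewrite mixture_cost_selection big1 => [|i _]; last first.
    by rewrite (cost_diag hc).
  rewrite mulr0 subr0 big1 => [|j _]; last first.
    by rewrite (psumr_eq0P _ W0)// mul0r.
  have : 0 <= w None * rho by rewrite mulr_ge0// ltW.
  by lra.
have [x Xx hx] := convex_combination cX Xxs (fun j => w0 (Some j)) W0.
set W := \sum_(j <- _) _ in W0 hx.
pose d := e / (2 * W).
have d0 : 0 < d by rewrite divr_gt0// mulr_gt0.
(* The shift [d / rho] makes [lam] positive. It loses at most [W * d = e / 2], and the tolerance
   [d / 2] loses [e / 4]; together less than [e]. *)
pose lam := w None / W + d / rho.
have lam0 : 0 < lam.
  by apply: ltr_wpDl; [rewrite divr_ge0// ltW|rewrite divr_gt0].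
have [s ms hs] := hb x lam (d / 2) Xx lam0 (divr_gt0 d0 (ltr0n _ 2)).
have := hx _ (payoff_convex ms); have := hw' _ ms.
under eq_bigr do rewrite mulrBr.
rewrite sumrB -mulr_suml -/W => h1 h2.
have mc := mixture_cost_ge0 ms.
have h3 : W * (b - d / 2) <= W * (payoff s x + lam * (rho - mixture_cost s)).
  by rewrite ler_wpM2l// ltW.
have h4 : W * (payoff s x + lam * (rho - mixture_cost s)) =
  W * payoff s x + w None * (rho - mixture_cost s) + W * d - W * (d / rho) * mixture_cost s.
  by rewrite /lam; field; rewrite !gt_eqF.
have h5 : W * d = e / 2 by rewrite /d; field; rewrite gt_eqF.
have h6 : 0 <= W * (d / rho) * mixture_cost s.
  by apply: mulr_ge0 => //; rewrite ltW// mulr_gt0// divr_gt0.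
by move: h3; rewrite h4 mulrBr mulrA h5; lra.
Qed.

End mixtures.

(** * Compactness of mixtures *)

(** A cluster point of an ultrafilter is a limit, since each preimage or its complement belongs to
    the filter. *)
Lemma ultra_cvg_compact (T : Type) (G : set_system T) (U : topologicalType)
    (f : T -> U) (A : set U) : UltraFilter G -> compact A -> G (f @^-1` A) ->
  exists2 u, A u & f @ G --> u.
Proof.
move=> UG cA GA; have PG := @ultra_proper _ _ UG.
have [u [Au clu]] := cA (f @ G) (fmap_proper_filter f PG) GA; exists u => // B nB.
have [//|GNB] := in_ultra_setVsetC (f @^-1` B) UG.
by have [y [yN yB]] := clu (~` B) B GNB nB.
Qed.

Section compactness.
Context {R : realType} (n m N K : nat) (N0 : (0 < N)%N).
Variables (X : set 'rV[R]_n) (Z : set 'rV[R]_m).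
Variables (c : 'rV[R]_m -> 'rV[R]_m -> R).
Variables (l : 'I_K -> 'rV[R]_n -> 'rV[R]_m -> R).
Variables (zhat : 'I_N -> 'rV[R]_m) (rho : R).
Variable PP : set (probability (borel R m) R).
Hypotheses (hc : transport_cost Z c) (hzhat : forall i, Z (zhat i)).
Hypothesis hreg : regularity X Z c l PP.
Local Notation mixture := (@mixture R m N K).
Local Notation is_mixture := (@is_mixture R m N K Z).
Local Notation mixture_cost := (mixture_cost c zhat).

Lemma cost_lower_semicontinuous z u e : Z z -> Z u -> 0 < e ->
  \forall z' \near z, Z z' -> c z u - e < c z' u.
Proof.
move=> Zz Zu e0; have ZZ : (Z `*` Z) (z, u) by [].
have lt : ((c z u - e)%:E < (c (z, u).1 (z, u).2)%:E)%E by rewrite lte_fin/= ltrBlDr ltrDl.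
have [V nV hV] := cost_lsc hc lt.
move: nV; rewrite /nbhs/= -(nbhs_subspace_in ZZ) => -[[P1 P2] /= [n1 n2] sub].
apply: filterS n1 => z' P1z' Zz'.
have := hV (z', u); rewrite lte_fin; apply; apply: (sub (z', u)); split => //=.
exact: nbhs_singleton.
Qed.

Lemma mixture_atom_le s i k b : is_mixture s -> mixture_cost s <= b ->
  s.1 i k * c (s.2 i k) (zhat i) <= N%:R * b.
Proof.
move=> [s0 _ sZ] sb.
have term0 j p : 0 <= s.1 j p * c (s.2 j p) (zhat j).
  by rewrite mulr_ge0// (cost_ge0 hc).
rewrite -ler_pdivrMl ?ltr0n//; apply: le_trans sb; rewrite ler_wpM2l ?invr_ge0//.
rewrite (bigD1 i)//= (bigD1 k)//= -addrA lerDl addr_ge0// ?sumr_ge0// => j _.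
by rewrite sumr_ge0.
Qed.

Section limit.
Variables (G : set_system mixture) (UG : UltraFilter G) (B : R).
Hypothesis Gmix : G is_mixture.
Hypothesis Gcost : G [set s | mixture_cost s <= B].

Let PG : ProperFilter G := @ultra_proper _ _ UG.
Let FG : Filter G := @filter_filter _ _ PG.

Lemma weight_cvg i k : exists2 a : R, 0 <= a & s.1 i k @[s --> G] --> a.
Proof.
have [||a a01 cv] := @ultra_cvg_compact _ G _ (fun s => s.1 i k) `[0, 1]%classic UG.
- exact: segment_compact.
- apply: filterS Gmix => s [s0 s1 _] /=; rewrite in_itv/= s0 /=.
  by rewrite -(s1 i) (bigD1 k)//= lerDl sumr_ge0.
by exists a => //; move: a01; rewrite /= in_itv/= => /andP[].
Qed.

(** The weight is eventually above [a / 2] and its share of the cost is bounded, so coercivity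
    confines the atom to a compact set. *)
Lemma atom_cvg i k (a : R) : 0 < a -> s.1 i k @[s --> G] --> a ->
  exists2 z, Z z & s.2 i k @[s --> G] --> z.
Proof.
move=> a0 cva; have [_ clZ _] := reg_Z hreg.
have [M hM] := cost_coercive hreg (N%:R * B / (a / 2)) (hzhat i).
pose A := Z `&` [set z | `|z| <= M].
have cA : compact A.
  apply: bounded_closed_compact.
    by exists M; split; [exact: num_real|move=> y My z [_ /= zM]; rewrite (le_trans zM)// ltW].
  apply: closedI => //.
  apply: (@preimage_closed _ _ (fun z : 'rV[R]_m => `|z|) [set t | t <= M]).
    by move=> z _; exact: norm_continuous.
  exact: closed_le.
have a2 : 0 < a / 2 by rewrite divr_gt0.
have Ga : \forall s \near G, a / 2 < s.1 i k.
  have := (@cvgrPdist_lt _ _ _ _ FG (fun s => s.1 i k) a).1 cva _ a2.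
  by apply: filterS => s; rewrite ltr_norml => /andP[_]; lra.
have [|z [Zz _] cvz] := @ultra_cvg_compact _ G _ (fun s => s.2 i k) A UG cA; last by exists z.
apply: filterS3 Gmix Gcost Ga => s ms sB sa; have [s0 _ sZ] := ms; split => //.
apply: (hM (s.2 i k)) => //.
rewrite ler_pdivlMr// mulrC; apply: le_trans (mixture_atom_le i k ms sB).
by rewrite ler_wpM2r ?(cost_ge0 hc)// ltW.
Qed.

(** With a positive limit weight this is upper semicontinuity of a concave function. With weight
    tending to 0, domination by a small multiple of the bounded cost share makes the contribution at
    most [d]. *)
Lemma payoff_atom_usc x i k (a : R) z (d : R) : X x -> Z z -> 0 < d -> 0 <= a ->
  s.1 i k @[s --> G] --> a -> (a = 0 \/ s.2 i k @[s --> G] --> z) ->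
  \forall s \near G, s.1 i k * l k x (s.2 i k) <= a * l k x z + d.
Proof.
move=> Xx Zz d0 a0 cva; have /cvgrPdist_lt hcva := cva; case=> [aE|cvz].
  (* [D] bounds the cost share of the atom, so the factor [d / 2 / D] on the cost leaves at most
     [d / 2]. *)
  pose D := N%:R * `|B| + 1.
  have D0 : 0 < D by rewrite /D ltr_wpDl// mulr_ge0.
  have e0 : 0 < d / 2 / D by rewrite !divr_gt0.
  have [C hC] := loss_dominated hreg k Xx (hzhat i) e0.
  have C0 : 0 < `|C| + 1 by rewrite ltr_wpDl.
  have := hcva _ (divr_gt0 (divr_gt0 d0 (ltr0n _ 2)) C0).
  apply: filterS3 Gmix Gcost => s ms sB; have [s0 _ sZ] := ms.
  rewrite aE sub0r normrN ger0_norm// ltr_pdivlMr// mul0r add0r => sC.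
  have h1 := ler_wpM2l (s0 i k) (hC _ (sZ i k)).
  have h2 := mixture_atom_le i k ms sB.
  have h3 : s.1 i k * C <= s.1 i k * (`|C| + 1).
    by rewrite ler_wpM2l// (le_trans (ler_norm _))// lerDl.
  have h4 : s.1 i k * c (s.2 i k) (zhat i) <= D.
    apply: le_trans h2 _; rewrite /D (@le_trans _ _ (N%:R * `|B|))// ?lerDl//.
    by rewrite ler_wpM2l// ler_norm.
  have h5 : d / 2 / D * (s.1 i k * c (s.2 i k) (zhat i)) <= d / 2.
    by rewrite -mulrA ger_pMr ?divr_gt0// mulrC ler_pdivrMr// mul1r.
  by move: h1; rewrite mulrDr (mulrCA (s.1 i k)); lra.
have d2 : 0 < d / 2 by rewrite divr_gt0.
have D0 : 0 < `|l k x z| + 1 by rewrite ltr_wpDl.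
have h1 : \forall s \near G, l k x (s.2 i k) < l k x z + d / 2.
  have h : G _ := cvz _ (convex_lower_semicontinuous z (reg_concave hreg k x) d2).
  by apply: filterS h => s /=; lra.
have ha := hcva _ (divr_gt0 d2 D0).
apply: filterS3 Gmix h1 ha => s [s0 s1 _] ls.
rewrite ltr_pdivlMr// => sa.
have s01 : s.1 i k <= 1 by rewrite -(s1 i) (bigD1 k)//= lerDl sumr_ge0.
have h2 := ler_wpM2l (s0 i k) (ltW ls).
have h3 : s.1 i k * (d / 2) <= d / 2 by rewrite ger_pMl.
have h4 : (s.1 i k - a) * l k x z <= `|a - s.1 i k| * (`|l k x z| + 1).
  rewrite (le_trans (ler_norm _))// normrM distrC ler_wpM2l// lerDl//.
by move: h2; rewrite mulrDr; move: h4; rewrite mulrBl; lra.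
Qed.

(** A vanishing atom may be dropped because costs are nonnegative; the others obey lower
    semicontinuity of the cost. *)
Lemma cost_atom_lsc i k (a : R) z (d : R) : Z z -> 0 < d -> 0 <= a ->
  s.1 i k @[s --> G] --> a -> (a = 0 \/ s.2 i k @[s --> G] --> z) ->
  \forall s \near G, a * c z (zhat i) - d <= s.1 i k * c (s.2 i k) (zhat i).
Proof.
move=> Zz d0 a0 cva; have /cvgrPdist_lt hcva := cva; case=> [aE|cvz].
  apply: filterS Gmix => s [s0 _ sZ]; rewrite aE mul0r sub0r.
  by rewrite (@le_trans _ _ 0)// ?oppr_le0 ?(ltW d0)// mulr_ge0// (cost_ge0 hc).
have d2 : 0 < d / 2 by rewrite divr_gt0.
have D0 : 0 < `|c z (zhat i)| + 1 by rewrite ltr_wpDl.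
have h1 : \forall s \near G, Z (s.2 i k) -> c z (zhat i) - d / 2 < c (s.2 i k) (zhat i).
  exact: cvz _ (cost_lower_semicontinuous Zz (hzhat i) d2).
have ha := hcva _ (divr_gt0 d2 D0).
apply: filterS3 Gmix h1 ha => s [s0 s1 sZ] /(_ (sZ i k)) ls.
rewrite ltr_pdivlMr// => sa.
have s01 : s.1 i k <= 1 by rewrite -(s1 i) (bigD1 k)//= lerDl sumr_ge0.
have h2 := ler_wpM2l (s0 i k) (ltW ls).
have h3 : s.1 i k * (d / 2) <= d / 2 by rewrite ger_pMl.
have h4 : (a - s.1 i k) * c z (zhat i) <= `|a - s.1 i k| * (`|c z (zhat i)| + 1).
  by rewrite (le_trans (ler_norm _))// normrM ler_wpM2l// lerDl.
by move: h2; rewrite mulrBr; move: h4; rewrite mulrBl; lra.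
Qed.

(* Along an ultrafilter the weights converge; an atom whose weight vanishes may
   escape to infinity, but by the growth condition it then contributes nothing. *)
Lemma mixture_limit : exists s0, [/\ is_mixture s0,
  (forall x e, X x -> 0 < e -> \forall s \near G, payoff l s x <= payoff l s0 x + e) &
  forall e, 0 < e -> \forall s \near G, mixture_cost s0 - e <= mixture_cost s].
Proof.
have lim (p : 'I_N * 'I_K) : exists q : R * 'rV[R]_m,
    [/\ 0 <= q.1, s.1 p.1 p.2 @[s --> G] --> q.1, Z q.2 &
      q.1 = 0 \/ s.2 p.1 p.2 @[s --> G] --> q.2].
  case: p => i k; have [a a0 cva] := weight_cvg i k.
  have [aE|aN0] := eqVneq a 0; first by exists (a, zhat i); split; rewrite /= ?aE; [|rewrite -aE| |left].
  have agt0 : 0 < a by rewrite lt_neqAle eq_sym aN0.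
  by have [z Zz cvz] := atom_cvg agt0 cva; exists (a, z); split; rewrite //=; right.
have [q hq] := choice lim.
pose s0 : mixture := (fun i k => (q (i, k)).1, fun i k => (q (i, k)).2).
have K1 : 0 < (K%:R + 1 : R) by rewrite ltr_wpDl.
(* An error [d] on every atom costs [K * d] in the mean, whence the tolerance [e / (K + 1)]. *)
have mean (f : 'I_N -> 'I_K -> R) (d : R) : N%:R^-1 * (\sum_i \sum_k (f i k + d)) =
    N%:R^-1 * (\sum_i \sum_k f i k) + K%:R * d.
  under eq_bigr do rewrite big_split/= sumr_const card_ord.
  rewrite big_split/= sumr_const card_ord mulrDr; congr (_ + _).
  by rewrite -[d *+ K *+ N]mulr_natl mulKf ?pnatr_eq0 -?lt0n// mulr_natl.
have small (e : R) : 0 < e -> K%:R * (e / (K%:R + 1)) <= e.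
  by move=> e0; rewrite mulrA ler_pdivrMr// mulrC ler_wpM2l ?lerDl// ltW.
exists s0; split.
- split => [i k|i|i k].
  + by have [] := hq (i, k).
  + have cv : \sum_k s.1 i k @[s --> G] --> \sum_k s0.1 i k.
      apply: cvg_big => [|k _]; first exact: add_continuous.
      by have [] := hq (i, k).
    have near1 : \forall s \near G, \sum_k s.1 i k = 1 by apply: filterS Gmix => s [].
    exact: (closed_cvg (fun t : R => t = 1) (@closed_eq _ 1) near1 _ cv).
  + by have [] := hq (i, k).
- move=> x e Xx e0; have ee : 0 < e / (K%:R + 1) by rewrite divr_gt0.
  have : \forall s \near G, forall p : 'I_N * 'I_K,
      s.1 p.1 p.2 * l p.2 x (s.2 p.1 p.2) <= s0.1 p.1 p.2 * l p.2 x (s0.2 p.1 p.2) + e / (K%:R + 1).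
    apply: filter_forall => -[i k]; have [q0 cv Zq cvz] := hq (i, k).
    exact: payoff_atom_usc.
  apply: filterS => s hs.
  apply: (@le_trans _ _ (N%:R^-1 * (\sum_i \sum_k (s0.1 i k * l k x (s0.2 i k) + e / (K%:R + 1))))).
    rewrite ler_wpM2l ?invr_ge0// ler_sum// => i _; rewrite ler_sum// => k _.
    exact: (hs (i, k)).
  by rewrite mean lerD2l small.
- move=> e e0; have ee : 0 < e / (K%:R + 1) by rewrite divr_gt0.
  have : \forall s \near G, forall p : 'I_N * 'I_K,
      s0.1 p.1 p.2 * c (s0.2 p.1 p.2) (zhat p.1) - e / (K%:R + 1) <=
      s.1 p.1 p.2 * c (s.2 p.1 p.2) (zhat p.1).
    apply: filter_forall => -[i k]; have [q0 cv Zq cvz] := hq (i, k).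
    exact: cost_atom_lsc.
  apply: filterS => s hs.
  apply: (@le_trans _ _ (N%:R^-1 * (\sum_i \sum_k (s0.1 i k * c (s0.2 i k) (zhat i) - e / (K%:R + 1))))).
    by rewrite mean mulrN lerD2l lerN2 small.
  rewrite ler_wpM2l ?invr_ge0// ler_sum// => i _; rewrite ler_sum// => k _.
  exact: (hs (i, k)).
Qed.

End limit.

Lemma mixture_compactness b :
  (forall (J : nat) (xs : 'I_J -> 'rV[R]_n) e, (forall j, X (xs j)) -> 0 < e ->
     exists s, [/\ is_mixture s, mixture_cost s <= rho + e &
       forall j, b - e <= payoff l s (xs j)]) ->
  exists s, [/\ is_mixture s, mixture_cost s <= rho & forall x, X x -> b <= payoff l s x].
Proof.
move=> hJ.
pose D : set (seq 'rV[R]_n * R) := 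
  [set p | (forall x, x \in (p.1 : seq _) -> X x) /\ 0 < p.2].
(* Filter base indexed by finitely many decisions and a tolerance; concatenation and minimum refine
   two members. An ultrafilter above it eventually meets every constraint. *)
pose Bs (p : seq 'rV[R]_n * R) : set mixture := [set s | [/\ is_mixture s,
  mixture_cost s <= rho + p.2 & forall x, x \in p.1 -> b - p.2 <= payoff l s x]].
have FF : Filter (filter_from D Bs).
  apply: filter_from_filter; first by exists ([::], 1); split.
  move=> [xs1 e1] [xs2 e2] [/= X1 e10] [/= X2 e20].
  exists (xs1 ++ xs2, Num.min e1 e2).
    split => /= [x|]; last by rewrite lt_min e10.
    by rewrite mem_cat => /orP[/X1|/X2].
  have m1 : Num.min e1 e2 <= e1 by rewrite ge_min lexx.
  have m2 : Num.min e1 e2 <= e2 by rewrite ge_min lexx orbT.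
  move=> s [/= ms cs ps]; split; split => //=; [lra| |lra|] => x xs.
    by have := ps x; rewrite mem_cat xs => /(_ isT); lra.
  by have := ps x; rewrite mem_cat xs orbT => /(_ isT); lra.
have PF : ProperFilter (filter_from D Bs).
  apply: filter_from_proper => -[xs e] [/= Xxs e0].
  have [j|s [ms cs ps]] := hJ (size xs) (fun j => nth 0 xs j) e _ e0.
    by apply: Xxs; exact: mem_nth.
  exists s; split => //= x xxs.
  have jlt : (index x xs < size xs)%N by rewrite index_mem.
  by have := ps (Ordinal jlt); rewrite /= nth_index.
have [G [UG FG]] := ultraFilterLemma PF.
have PG := @ultra_proper _ _ UG.
have Gfin xs e : (forall x, x \in xs -> X x) -> 0 < e -> G (Bs (xs, e)).
  by move=> Xxs e0; apply: FG; exists (xs, e).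
have G1 : G (Bs ([::], 1)) by exact: Gfin.
have [||s0 [ms0 up lo]] := mixture_limit UG (B := rho + 1).
- by apply: filterS G1 => s [].
- by apply: filterS G1 => s [].
exists s0; split => //.
  apply/ler_addgt0Pr => e e0; have e2 : 0 < e / 2 by rewrite divr_gt0.
  have X0 x : x \in [::] -> X x by [].
  have [s [h1 [_ h2 _]]] := filter_ex (filterI (lo _ e2) (Gfin [::] _ X0 e2)).
  by move: h1 h2 => /=; lra.
move=> x Xx; apply/ler_addgt0Pr => e e0; have e2 : 0 < e / 2 by rewrite divr_gt0.
have Xs y : y \in [:: x] -> X y by rewrite inE => /eqP ->.
have [s [h1 [_ _ h2]]] := filter_ex (filterI (up _ _ Xx e2) (Gfin [:: x] _ Xs e2)).
by move: h1 (h2 x (mem_head _ _)) => /=; lra.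
Qed.

End compactness.

(** * Fenchel duality and linear dependence *)

Section fenchel.
Context {R : realType} (n : nat) (P : finType).
Variables (X : set 'rV[R]_n) (beta : P -> R) (f : P -> 'rV[R]_n -> R) (b : R).
Hypotheses (X0 : X !=set0) (X_convex : convex_set X).
Hypotheses (beta0 : forall p, 0 <= beta p).
Hypothesis f_convex : forall p, convex_function setT (f p).
Hypothesis b_le : forall x, X x -> b <= \sum_p beta p * f p x.

(* The multipliers form a subgradient at 0 of the perturbation function
   [u |-> inf_(x in X) \sum_p beta p * f p (x + u p)]. *)
Lemma decoupling_multipliers : exists y : P -> 'rV[R]_n,
  forall x (x' : P -> 'rV[R]_n), X x ->
    b <= \sum_p beta p * (f p (x' p) - dot (y p) (x' p - x)).
Proof.
pose E (u : P * 'I_n -> R) : set R := [set t |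
  exists2 x, X x & \sum_p beta p * f p (x + \row_j u (p, j)) <= t].
have [|||w hw] := @convex_graph_support R _ E b.
- by move=> u; have [x Xx] := X0; eexists; exists x.
- move=> t [x Xx]; apply: le_trans; apply: le_trans (b_le Xx) _.
  by rewrite (_ : \row__ 0 = 0) ?addr0//; apply/rowP => j; rewrite !mxE.
- move=> u u' a a' t [x Xx hx] [x' Xx' hx'] t01.
  exists (t *: x + (1 - t) *: x'); first exact: (convex_setP X_convex).
  have /andP[t0 t1] := t01.
  apply: le_trans (lerD (ler_wpM2l t0 hx) (ler_wpM2l _ hx')); last by rewrite subr_ge0.
  rewrite !mulr_sumr -big_split ler_sum//= => p _.
  rewrite !(mulrCA _ (beta p)) -mulrDr ler_wpM2l//.
  apply: le_trans (convex_functionP (f_convex p) _ _ t01) => //.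
  rewrite le_eqVlt; apply/orP; left; apply/eqP; congr (f p _).
  by apply/rowP => j; rewrite !mxE; ring.
(* The subgradient component at [p] is [beta p *: y p]. Where [beta p] vanishes, no shift is made
   and the multiplier is irrelevant. *)
exists (fun p => if beta p == 0 then 0 else (beta p)^-1 *: \row_j w (p, j)).
move=> x x' Xx.
pose u (q : P * 'I_n) := if beta q.1 == 0 then 0 else (x' q.1 - x) 0 q.2.
have Eu : E u (\sum_p beta p * f p (x' p)).
  exists x => //; apply: ler_sum => p _; rewrite /u/=.
  have [->|_] := eqVneq (beta p) 0; first by rewrite !mul0r.
  rewrite (_ : x + _ = x' p)//; apply/rowP => j; rewrite !mxE; ring.
have := hw _ _ Eu; rewrite -lerBrDr => /le_trans; apply.
have -> : \sum_q w q * u q = \sum_p \sum_j w (p, j) * u (p, j).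
  by rewrite pair_bigA; apply: eq_bigr => -[].
rewrite -sumrB ler_sum// => p _.
rewrite mulrBr lerD2l lerN2 /u/=; have [->|bp] := eqVneq (beta p) 0.
  by rewrite mul0r sumr_ge0// => j _; rewrite mulr0.
rewrite dotZl mulVKf// dotE ler_sum// => j _.
by rewrite !mxE.
Qed.

(** In the decoupled inequality the points [x' p] and [x] vary independently, so the suprema can be
    taken separately; they yield the conjugates and the support function. *)
Lemma fenchel_duality : exists (y : P -> 'rV[R]_n) (C : P -> R) (tau : R),
  [/\ forall p, beta p != 0 ->
        ereal_sup [set (dot (y p) x - f p x)%:E | x in setT] = (C p)%:E,
      support_function X (- \sum_p beta p *: y p) = tau%:E &
      b <= - \sum_p beta p * C p - tau].
Proof.
have [y hy] := decoupling_multipliers; have [x0 Xx0] := X0.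
set th := - \sum_p beta p *: y p.
pose S p : set R := [set dot (y p) x - f p x | x in setT].
pose T : set R := [set dot th x | x in X].
have dotth x : dot th x = - \sum_p beta p * dot (y p) x.
  rewrite /th -scaleN1r dotZl dot_suml mulN1r; congr (- _).
  by apply: eq_bigr => p _; rewrite dotZl.
have hy' x (x' : P -> 'rV[R]_n) : X x ->
    \sum_p beta p * (dot (y p) (x' p) - f p (x' p)) + dot th x <= - b.
  move=> Xx; have := hy _ x' Xx; rewrite dotth.
  suff -> : \sum_p beta p * (f p (x' p) - dot (y p) (x' p - x)) =
    - (\sum_p beta p * (dot (y p) (x' p) - f p (x' p))) + \sum_p beta p * dot (y p) x by lra.
  rewrite -sumrN -big_split/=; apply: eq_bigr => p _.
  by rewrite dotDr -[- x]scaleN1r dotZr; ring.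
(* Only [x' p] moves, all other points stay at [x0]; the bound is divided by [beta p]. *)
have hS p : beta p != 0 -> has_sup (S p).
  move=> bp; split; first by exists (dot (y p) x0 - f p x0), x0.
  pose D := \sum_(q | q != p) beta q * (dot (y q) x0 - f q x0) + dot th x0.
  exists ((- b - D) / beta p) => _ [x _ <-].
  have := hy' x0 (fun q => if q == p then x else x0) Xx0.
  rewrite (bigD1 p)//= eqxx (eq_bigr (fun q => beta q * (dot (y q) x0 - f q x0))).
    by rewrite ler_pdivlMr ?lt_neqAle 1?eq_sym ?bp ?beta0//= /D mulrC; lra.
  by move=> q /negbTE ->.
have hT : has_sup T.
  split; first by exists (dot th x0), x0.
  exists (- b - \sum_p beta p * (dot (y p) x0 - f p x0)) => _ [x Xx <-].
  by have := hy' x (fun=> x0) Xx; lra.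
exists y, (fun p => sup (S p)), (sup T); split.
- by move=> p bp; have [S0 ubS] := hS p bp; rewrite -ereal_sup_EFin// image_comp.
- by have [T0 ubT] := hT; rewrite -ereal_sup_EFin// image_comp.
suff : \sum_p beta p * sup (S p) + sup T <= - b by lra.
apply/ler_addgt0Pr => e e0.
(* The errors [e / B] of the near maximizers, weighted by [beta] and by 1 for [tau], add up to
   [e]. *)
pose B := \sum_p beta p + 1.
have B0 : 0 < B by rewrite ltr_wpDl// sumr_ge0.
have d0 : 0 < e / B by rewrite divr_gt0.
have [_ [x Xx <-] hx] := sup_adherent d0 hT.
have ex p : exists x', beta p * (sup (S p) - e / B) <= beta p * (dot (y p) x' - f p x').
  have [->|bp] := eqVneq (beta p) 0; first by exists x0; rewrite !mul0r.
  have [_ [x' _ <-] hx'] := sup_adherent d0 (hS p bp).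
  by exists x'; rewrite ler_wpM2l// ltW.
have [x' hx'] := choice ex.
have := hy' x x' Xx.
have : \sum_p beta p * (sup (S p) - e / B) <=
    \sum_p beta p * (dot (y p) (x' p) - f p (x' p)) by exact: ler_sum.
have -> : \sum_p beta p * (sup (S p) - e / B) =
    \sum_p beta p * sup (S p) - (B - 1) * (e / B).
  rewrite /B addrK mulr_suml -sumrB; apply: eq_bigr => p _; exact: mulrBr.
have : B * (e / B) = e by rewrite mulrC divfK// gt_eqF.
by rewrite mulrBl mul1r; lra.
Qed.

End fenchel.

(** A matrix with more rows than columns has a nonzero left kernel vector, here extended by 0
    outside [A]. *)
Lemma linear_dependence (F : fieldType) (I : finType) (q : nat) (A : {set I})
    (f : I -> 'rV[F]_q) : (q < #|A|)%N -> exists d : I -> F,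
  [/\ exists i, d i != 0, forall i, i \notin A -> d i = 0 & \sum_i d i *: f i = 0].
Proof.
move=> qA; pose M := \matrix_(j < #|A|) f (enum_val j).
have : kermx M != 0.
  by rewrite kermx_eq0 /row_free neq_ltn (leq_ltn_trans (rank_leq_col _) qA).
case/rowV0Pn => v /sub_kermxP vM /rV0Pn[j vj].
have h := enum_valP j.
exists (fun i => if i \in A then v 0 (enum_rank_in h i) else 0); split.
- by exists (enum_val j); rewrite enum_valP enum_valK_in.
- by move=> i /negbTE ->.
rewrite -[RHS]vM mulmx_sum_row (bigID (mem A))/= [X in _ + X]big1 ?addr0; last first.
  by move=> i /negbTE ->; rewrite scale0r.
rewrite big_enum_val; apply: eq_bigr => i _.
by rewrite enum_valP enum_valK_in rowK.
Qed.

Section caratheodory.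
Context {R : realFieldType} (I : finType).

(* One pivot of the simplex method: move along [d] until a weight vanishes. *)
Lemma ratio_pivot (a d : I -> R) : (forall i, 0 <= a i) -> (exists i, d i < 0) ->
  (forall i, a i = 0 -> d i = 0) ->
  exists t : R, [/\ 0 <= t, forall i, 0 <= a i + t * d i &
    exists i, a i != 0 /\ a i + t * d i = 0].
Proof.
move=> a0 [i0 di0] ad.
have [i di imin] := @arg_minP _ _ _ i0 (fun i => d i < 0) (fun i => a i / - d i) di0.
have t0 : 0 <= a i / - d i by rewrite divr_ge0// oppr_ge0 ltW.
exists (a i / - d i); split => //.
  move=> j; have [dj|dj] := ltP (d j) 0; last by rewrite addr_ge0// mulr_ge0.
  have := imin j dj; rewrite ler_pdivlMr ?oppr_gt0// mulrN; lra.
exists i; split; last by field; rewrite lt_eqF.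
by apply/eqP => ai; move: di; rewrite ad ?ltxx.
Qed.

End caratheodory.

(** * Strong duality *)

Lemma sum_pair (V : nmodType) (I J : finType) (F : I * J -> V) :
  \sum_p F p = \sum_i \sum_j F (i, j).
Proof. by rewrite pair_bigA; apply: eq_bigr => -[]. Qed.

Section strong_duality.
Context {R : realType} (n m N K : nat) (N0 : (0 < N)%N).
Variables (X : set 'rV[R]_n) (Z : set 'rV[R]_m).
Variables (c : 'rV[R]_m -> 'rV[R]_m -> R).
Variables (l : 'I_K -> 'rV[R]_n -> 'rV[R]_m -> R).
Variables (zhat : 'I_N -> 'rV[R]_m) (rho : R).
Hypotheses (hc : transport_cost Z c) (hzhat : forall i, Z (zhat i)) (hrho : 0 < rho).
Hypothesis hreg : regularity X Z c l (ambiguity_set Z c N0 zhat rho).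

Let K0 : (0 < K)%N. Proof. exact: ltnW (reg_K hreg). Qed.

Local Notation dual_value :=
  (ereal_sup [set dual_DRO_objective l X Q | Q in ambiguity_set Z c N0 zhat rho]).
Local Notation feasible := (program_feasible Z c zhat rho).
Local Notation objective := (program_objective X l zhat).

Definition lagrangian_range x lam u : set R :=
  [set l p.1 x p.2 - lam * c p.2 u | p in [set p : 'I_K * 'rV[R]_m | Z p.2]].

Lemma has_sup_lagrangian_range x lam i : X x -> 0 < lam ->
  has_sup (lagrangian_range x lam (zhat i)).
Proof.
move=> Xx lam0; split.
  by eexists; exists (Ordinal K0, zhat i) => //=; exact: hzhat.
have [C hC] := choice (fun k => loss_dominated hreg k Xx (hzhat i) lam0).
exists (\sum_k `|C k|) => _ [[k z] /= Zz <-].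
have := hC k z Zz; rewrite -lerBlDr => /le_trans; apply.
by rewrite (bigD1 k)//= (le_trans (ler_norm _))// lerDl sumr_ge0.
Qed.

Lemma dual_value_le_lagrangian x lam : X x -> 0 < lam ->
  (dual_value <= (lam * rho +
     N%:R^-1 * \sum_i sup (lagrangian_range x lam (zhat i)))%:E)%E.
Proof.
move=> Xx lam0; apply: ge_ereal_sup => _ [Q PQ <-].
apply: (@le_trans _ _ (expected_loss l Q x)).
  by apply: ereal_inf_lbound; exists x.
have [_ clZ _] := reg_Z hreg.
apply: (expected_loss_le_lagrangian hc hzhat K0 (reg_concave hreg) clZ PQ lam0
  (M := fun u => sup (lagrangian_range x lam u))) => i k z Zz.
rewrite -lerBlDr; apply: ub_le_sup; first by have [] := has_sup_lagrangian_range i Xx lam0.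
by exists (k, z).
Qed.

(** The Lagrangian bound splits over the samples; one nearly optimal pair of piece and atom per
    sample makes up a [selection]. *)
Lemma lagrangian_mixture b x lam d : (b%:E <= dual_value)%E ->
  X x -> 0 < lam -> 0 < d -> exists2 s, @is_mixture R m N K Z s &
    b - d <= payoff l s x + lam * (rho - mixture_cost c zhat s).
Proof.
move=> bD Xx lam0 d0.
have ex i : exists p : 'I_K * 'rV[R]_m, Z p.2 /\
    sup (lagrangian_range x lam (zhat i)) - d <= l p.1 x p.2 - lam * c p.2 (zhat i).
  have [_ [p Zp <-] hp] := sup_adherent d0 (has_sup_lagrangian_range i Xx lam0).
  by exists p; split => //; exact: ltW.
have [p hp] := choice ex.
exists (selection (fun i => (p i).1) (fun i => (p i).2)).
  by apply: selection_mixture => i; have [] := hp i.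
rewrite payoff_selection mixture_cost_selection.
have := le_trans bD (dual_value_le_lagrangian Xx lam0); rewrite lee_fin => h.
have : N%:R^-1 * (\sum_i (sup (lagrangian_range x lam (zhat i)) - d)) <=
  N%:R^-1 * (\sum_i (l (p i).1 x (p i).2 - lam * c (p i).2 (zhat i))).
  by rewrite ler_wpM2l ?invr_ge0// ler_sum// => i _; have [] := hp i.
rewrite !sumrB sumr_const card_ord -mulr_sumr !mulrBr.
rewrite -[d *+ N]mulr_natl mulKf ?pnatr_eq0 -?lt0n// (mulrCA lam).
by lra.
Qed.

Lemma saddle_mixture b : (b%:E <= dual_value)%E ->
  exists s, [/\ @is_mixture R m N K Z s, mixture_cost c zhat s <= rho &
    forall x, X x -> b <= payoff l s x].
Proof.
move=> bD; have [_ _ cZ] := reg_Z hreg; have [_ cX] := reg_X hreg.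
apply: (mixture_compactness N0 hc hzhat hreg) => J xs e Xxs e0.
apply: (minimax_finite hc hzhat cZ (reg_convex hreg) (reg_concave hreg) K0 hrho cX Xxs e0).
by move=> x lam d; exact: lagrangian_mixture.
Qed.

(** Finiteness of the conjugates at positive weights is recorded because it makes the objective
    linear in [alpha] during the support reduction. *)
Lemma program_of_mixture s b : @is_mixture R m N K Z s ->
  mixture_cost c zhat s <= rho -> (forall x, X x -> b <= payoff l s x) ->
  exists s' : variables R n m N K, [/\ feasible s', (b%:E <= objective s')%E &
    forall i k, alpha s' i k != 0 ->
      conjugate1 (l k) (y s' i k) (zhat i + v s' i k) \is a fin_num].
Proof.
move=> [a0 a1 aZ] cost_le b_le; have [X0 cX] := reg_X hreg.
pose beta (p : 'I_N * 'I_K) := N%:R^-1 * s.1 p.1 p.2.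
pose f (p : 'I_N * 'I_K) x := l p.2 x (s.2 p.1 p.2).
have [||x Xx|y [C [tau [hC htau bC]]]] := @fenchel_duality R n _ X beta f b X0 cX.
- by move=> p; rewrite mulr_ge0 ?invr_ge0.
- by move=> p; exact: reg_convex hreg _ _.
- have := b_le x Xx; rewrite /payoff mulr_sumr => /le_trans; apply.
  rewrite sum_pair ler_sum// => i _.
  by rewrite mulr_sumr ler_sum// => k _; rewrite /beta/= mulrA.
have NV : N%:R^-1 != 0 :> R by rewrite invr_eq0 pnatr_eq0 -lt0n.
(* With [nu = 1] this [theta] makes stationarity hold by construction. *)
pose s' := @ProgramVariables R n m N K (- \sum_p beta p *: y p) 1 s.1
  (fun i k => s.2 i k - zhat i) (fun i k => y (i, k)).
have atomE i k : zhat i + v s' i k = s.2 i k by rewrite /= addrC subrK.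
have conjE i k : s.1 i k != 0 ->
    conjugate1 (l k) (y (i, k)) (zhat i + v s' i k) = (C (i, k))%:E.
  by move=> sik; rewrite atomE -hC// mulf_neq0.
exists s'; split.
- split => //=.
  + by move=> i k; rewrite -/(v s' i k) atomE.
  + rewrite scale1r sum_pair.
    apply/eqP; rewrite subr_eq0 scaler_sumr; apply/eqP/eq_bigr => i _.
    by rewrite scaler_sumr; apply: eq_bigr => k _; rewrite scalerA.
  + apply: le_trans cost_le; rewrite ler_wpM2l ?invr_ge0// ler_sum// => i _.
    by rewrite ler_sum// => k _; rewrite -/(v s' i k) atomE.
- rewrite /program_objective [nu s']/= [theta s']/= htau.
  rewrite (eq_bigr (fun i => (\sum_k s.1 i k * C (i, k))%:E)) => [|i _]; last first.
    rewrite -sumEFin; apply: eq_bigr => k _ /=; rewrite EFinM.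
    by have [->|sik] := eqVneq (s.1 i k) 0; rewrite ?mul0e// -/(v s' i k) conjE.
  rewrite sumEFin -!EFinM -EFinN -EFinB lee_fin mul1r.
  apply: le_trans bC _; rewrite lerD2r lerN2 mulr_sumr.
  rewrite sum_pair ler_sum// => i _.
  by rewrite mulr_sumr ler_sum// => k _; rewrite mulrA.
- by move=> i k sik; rewrite conjE.
Qed.

(** Induction on the support size: a dependence among the constraint columns of the nonzero weights
    is a direction that keeps all constraints, and moving along it removes an atom. *)
Lemma support_reduction (s : variables R n m N K) : feasible s ->
  (forall i k, alpha s i k != 0 ->
     conjugate1 (l k) (y s i k) (zhat i + v s i k) \is a fin_num) ->
  exists s', [/\ feasible s', (objective s <= objective s')%E &
    (#|[set ik : 'I_N * 'I_K | alpha s' ik.1 ik.2 != 0%R]%SET| <= N + n + 1)%N].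
Proof.
have [r] := ubnP #|[set ik : 'I_N * 'I_K | alpha s ik.1 ik.2 != 0%R]%SET|.
elim: r s => // r IH s sr fs fin.
set A := [set ik | _]%SET in sr.
have [Ale|Agt] := leqP #|A| (N + n + 1); first by exists s.
pose cst i k := c (zhat i + v s i k) (zhat i).
pose C i k := fine (conjugate1 (l k) (y s i k) (zhat i + v s i k)).
have [d [dN0 dA dn dy [dc dC]]] : exists d : 'I_N * 'I_K -> R,
    [/\ exists ik, d ik != 0, forall ik, alpha s ik.1 ik.2 = 0 -> d ik = 0,
        forall i, \sum_k d (i, k) = 0, \sum_i \sum_k d (i, k) *: y s i k = 0 &
        \sum_i \sum_k d (i, k) * cst i k = 0 /\ \sum_i \sum_k d (i, k) * C i k <= 0].
  (* Column of [alpha_ik] in the constraints: [N] normalizations, [n] stationarity equations and the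
     budget. *)
  pose g (ik : 'I_N * 'I_K) : 'rV[R]_(N + n + 1) :=
    row_mx (row_mx (delta_mx 0 ik.1) (y s ik.1 ik.2)) (cst ik.1 ik.2)%:M.
  have [d [dN0 dA dg]] := linear_dependence g Agt.
  have dA' ik : alpha s ik.1 ik.2 = 0 -> d ik = 0.
    by move=> h; apply: dA; rewrite inE h eqxx.
  have dn i : \sum_k d (i, k) = 0.
    have := congr1 (fun w : 'rV_(N + n + 1) => lsubmx (lsubmx w) 0 i) dg.
    rewrite !linear_sum/= !linear0 summxE mxE.
    rewrite sum_pair (bigD1 i)//= [X in _ + X]big1 => [|j ji]; last first.
      apply: big1 => k _; rewrite !linearZ/= !row_mxKl !mxE.
      by rewrite eqxx eq_sym (negbTE ji) mulr0.
    rewrite addr0 => h; rewrite -[RHS]h; apply: eq_bigr => k _.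
    by rewrite !linearZ/= !row_mxKl !mxE !eqxx mulr1.
  have dy : \sum_i \sum_k d (i, k) *: y s i k = 0.
    have := congr1 (fun w : 'rV_(N + n + 1) => rsubmx (lsubmx w)) dg.
    rewrite !linear_sum/= !linear0 => h; rewrite -[RHS]h.
    rewrite pair_bigA; apply: eq_bigr => -[i k] _.
    by rewrite !linearZ/= row_mxKl row_mxKr.
  have dc : \sum_i \sum_k d (i, k) * cst i k = 0.
    have := congr1 (fun w : 'rV_(N + n + 1) => rsubmx w 0 0) dg.
    rewrite !linear_sum/= !linear0 summxE mxE => h; rewrite -[RHS]h.
    rewrite pair_bigA; apply: eq_bigr => -[i k] _.
    by rewrite !linearZ/= row_mxKr !mxE eqxx mulr1n.
  (* The objective takes no coordinate of [g]: replacing [d] by [- d] if necessary makes it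
     nondecreasing along [d]. *)
  have [dC|/ltW dC] := leP (\sum_i \sum_k d (i, k) * C i k) 0; first by exists d.
  have oppE (h : 'I_N -> 'I_K -> R) :
      \sum_i \sum_k - d (i, k) * h i k = - \sum_i \sum_k d (i, k) * h i k.
    rewrite -sumrN; apply: eq_bigr => i _; rewrite -sumrN.
    by apply: eq_bigr => k _; rewrite mulNr.
  exists (fun ik => - d ik); split.
  - by have [ik ?] := dN0; exists ik; rewrite oppr_eq0.
  - by move=> ik /dA' ->; rewrite oppr0.
  - by move=> i; rewrite sumrN dn oppr0.
  - under eq_bigr do under eq_bigr do rewrite scaleNr.
    by under eq_bigr do rewrite sumrN; rewrite sumrN dy oppr0.
  - by rewrite !oppE dc oppr0 oppr_le0.
(* A nonzero direction whose sums over [k] all vanish has a negative entry. *)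
have dneg : exists ik, d ik < 0.
  have [[i k] dik] := dN0; apply: contrapT => nneg.
  have d0 j : 0 <= d (i, j).
    by rewrite leNgt; apply/negP => dj; apply: nneg; exists (i, j).
  by move: dik; rewrite (psumr_eq0P _ (dn i)) ?eqxx.
have [t [t0 at0 [p [ap apt]]]] :=
  @ratio_pivot _ _ (fun ik => alpha s ik.1 ik.2) d (fun ik => alpha_ge0 fs _ _) dneg dA.
pose s' := @ProgramVariables R n m N K (theta s) (nu s)
  (fun i k => alpha s i k + t * d (i, k)) (v s) (y s).
have sumE (h : 'I_N -> 'I_K -> R) : \sum_i \sum_k alpha s' i k * h i k =
    \sum_i \sum_k alpha s i k * h i k + t * \sum_i \sum_k d (i, k) * h i k.
  rewrite mulr_sumr -big_split/=; apply: eq_bigr => i _.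
  rewrite mulr_sumr -big_split/=; apply: eq_bigr => k _.
  by rewrite mulrDl mulrA.
have fs' : feasible s'.
  split.
  - exact: nu_ge0 fs.
  - by move=> i k; exact: (at0 (i, k)).
  - exact: atom_in fs.
  - rewrite -[RHS](stationarity fs); congr (_ *: _ + _) => /=.
    under eq_bigr do (under eq_bigr do rewrite scalerDl -scalerA; rewrite big_split/= -scaler_sumr).
    by rewrite big_split/= -scaler_sumr dy scaler0 addr0.
  - by rewrite (sumE cst) dc mulr0 addr0; exact: budget fs.
  - by move=> i; rewrite /= big_split/= -mulr_sumr dn mulr0 addr0 (alpha_sum fs).
(* Zero weights stay zero, so a possibly infinite conjugate never enters the objective. *)
have a'0 i k : alpha s i k = 0 -> alpha s' i k = 0.
  by move=> aik /=; rewrite aik (dA (i, k) aik) mulr0 addr0.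
have termE (a : R) i k : (alpha s i k = 0 -> a = 0) ->
    (a%:E * conjugate1 (l k) (y s i k) (zhat i + v s i k)%R = (a * C i k)%:E)%E.
  move=> h; have [/h ->|aik] := eqVneq (alpha s i k) 0; first by rewrite mul0e mul0r.
  by rewrite EFinM /C fineK// fin.
have objE (s1 : variables R n m N K) : y s1 = y s -> v s1 = v s ->
    (forall i k, alpha s i k = 0 -> alpha s1 i k = 0) ->
    (\sum_(i < N) \sum_(k < K)
       (alpha s1 i k)%:E * conjugate1 (l k) (y s1 i k) (zhat i + v s1 i k)%R =
     (\sum_i \sum_k alpha s1 i k * C i k)%:E)%E.
  move=> -> -> h; rewrite -sumEFin; apply: eq_bigr => i _; rewrite -sumEFin.
  by apply: eq_bigr => k _; apply: termE; exact: h.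
have obj_le : (objective s <= objective s')%E.
  rewrite /program_objective objE// objE//; apply: leeB => //; rewrite leeN2.
  rewrite lee_wpmul2l ?lee_fin ?invr_ge0// sumE gerDl.
  by rewrite mulr_ge0_le0.
have proper_supp : ([set ik : 'I_N * 'I_K | alpha s' ik.1 ik.2 != 0%R] \proper A)%SET.
  apply/properP; split.
    by apply/fintype.subsetP => -[i k]; rewrite !inE; apply: contra_neq; exact: a'0.
  exists p; rewrite !inE//; move: p ap apt => [i k] /= _ ->.
  by rewrite eqxx.
have [|//|i k aik|s'' [fs'' le_obj card_le]] := IH s'.
- exact: leq_trans (proper_card proper_supp) sr.
- by apply: fin; apply: contra_neq aik; exact: a'0.
by exists s''; split => //; exact: le_trans le_obj.
Qed.

(** The empirical distribution itself, one atom per sample. It serves when the dual value is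
    [-oo]. *)
Lemma program_feasible_exists : exists s : variables R n m N K, feasible s /\
  (#|[set ik : 'I_N * 'I_K | alpha s ik.1 ik.2 != 0%R]%SET| <= N + n + 1)%N.
Proof.
pose s := @ProgramVariables R n m N K 0 0
  (selection (fun=> Ordinal K0) zhat).1 (fun _ _ => 0) (fun _ _ => 0).
have [m1 m2 _] := @selection_mixture R m N K Z (fun=> Ordinal K0) zhat hzhat.
exists s; split.
  split => //=.
  - by move=> i k; rewrite addr0.
  - rewrite big1 ?scaler0 ?scale0r ?addr0// => i _.
    by rewrite big1// => k _; rewrite scaler0.
  - rewrite big1 ?mulr0 ?(ltW hrho)// => i _; rewrite big1// => k _.
    by rewrite addr0 (cost_diag hc) ?mulr0.
apply: (@leq_trans N); last by rewrite -addnA leq_addr.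
rewrite -[X in (_ <= X)%N](card_ord N).
rewrite -(card_imset predT (f := fun i : 'I_N => (i, Ordinal K0))) => [|i j [] //].
apply/subset_leq_card/fintype.subsetP => -[i k]; rewrite inE /=.
have [->|_] := eqVneq k (Ordinal K0).
  by move=> _; apply/imsetP; exists i.
by rewrite eqxx.
Qed.

Lemma optimal_program_exists : exists s : variables R n m N K, [/\ feasible s,
  (dual_value <= objective s)%E &
  (#|[set ik : 'I_N * 'I_K | alpha s ik.1 ik.2 != 0%R]%SET| <= N + n + 1)%N].
Proof.
case E : dual_value => [b| |].
- have [s [ms cost_le pay]] : exists s, [/\ @is_mixture R m N K Z s,
      mixture_cost c zhat s <= rho & forall x, X x -> b <= payoff l s x].
    by apply: saddle_mixture; rewrite E.
  have [s1 [fs1 bs1 fin1]] := program_of_mixture ms cost_le pay.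
  have [s2 [fs2 le2 card2]] := support_reduction fs1 fin1.
  by exists s2; split => //; exact: le_trans le2.
(* The value [+oo] is excluded by the finite Lagrangian bound at [lam = 1]. *)
- have [[x Xx] _] := reg_X hreg.
  by have := dual_value_le_lagrangian Xx ltr01; rewrite E leye_eq.
- by have [s [fs card_s]] := program_feasible_exists; exists s; rewrite leNye.
Qed.

End strong_duality.

Theorem proposition2 (R : realType) (n m N K : nat) (N0 : (0 < N)%N)
    (X : set 'rV[R]_n) (Z : set 'rV[R]_m)
    (c : 'rV[R]_m -> 'rV[R]_m -> R)
    (l : 'I_K -> 'rV[R]_n -> 'rV[R]_m -> R)
    (zhat : 'I_N -> 'rV[R]_m) (rho : R)
    (hc : transport_cost Z c)
    (hzhat : forall i, Z (zhat i))
    (hrho : 0 < rho)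
    (hreg : regularity X Z c l (ambiguity_set Z c N0 zhat rho)) :
  [/\ ereal_sup [set dual_DRO_objective l X Q
                | Q in ambiguity_set Z c N0 zhat rho]
      = ereal_sup [set program_objective X l zhat s
                  | s in program_feasible Z c zhat rho],
      forall (s : variables R n m N K) (fs : program_feasible Z c zhat rho s),
        is_maximizer (program_feasible Z c zhat rho)
          (program_objective X l zhat) s ->
        is_maximizer (ambiguity_set Z c N0 zhat rho)
          (dual_DRO_objective l X) (dual_distribution N0 fs),
      exists s : variables R n m N K,
        is_maximizer (program_feasible Z c zhat rho)
          (program_objective X l zhat) s /\
        (#|[set ik : 'I_N * 'I_K | alpha s ik.1 ik.2 != 0%R]%SET|
          <= minn (N + n + 1) (K * N))%N
    & exists (Q : probability (borel R m) R) (S : seq 'rV[R]_m),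
        [/\ is_maximizer (ambiguity_set Z c N0 zhat rho)
              (dual_DRO_objective l X) Q,
            Q [set z | z \in S] = 1%E
          & (size S <= minn (N + n + 1) (K * N))%N]].
Proof.
have K0 : (0 < K)%N := ltnW (reg_K hreg).
have [s [fs ge_s card_s]] := optimal_program_exists hc hzhat hrho hreg.
set D := ereal_sup _ in ge_s *.
have PP s' (fs' : program_feasible Z c zhat rho s') := dual_distribution_in_ambiguity_set N0 hc hzhat fs'.
have le_dual s' (fs' : program_feasible Z c zhat rho s') :
  (program_objective X l zhat s' <= dual_DRO_objective l X (dual_distribution N0 fs'))%E.
  by apply: program_objective_le_dual => //; exact: reg_concave hreg.
have le_D Q : ambiguity_set Z c N0 zhat rho Q -> (dual_DRO_objective l X Q <= D)%E.
  by move=> PQ; apply: ereal_sup_ubound; exists Q.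
(* Weak duality bounds every objective by [D], and [s] reaches [D]. *)
have max_s : is_maximizer (program_feasible Z c zhat rho) (program_objective X l zhat) s.
  split => // s' fs'; apply: le_trans ge_s.
  by apply: le_trans (le_dual _ fs') _; apply: le_D; exact: PP.
have max_dual s' (fs' : program_feasible Z c zhat rho s') :
    is_maximizer (program_feasible Z c zhat rho) (program_objective X l zhat) s' ->
    is_maximizer (ambiguity_set Z c N0 zhat rho) (dual_DRO_objective l X)
      (dual_distribution N0 fs').
  move=> [_ max_s']; split; first exact: PP.
  move=> Q /le_D /le_trans; apply; apply: le_trans ge_s _.
  exact: le_trans (max_s' _ fs) (le_dual _ fs').
have card_le : (#|[set ik : 'I_N * 'I_K | alpha s ik.1 ik.2 != 0%R]%SET|
    <= minn (N + n + 1) (K * N))%N.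
  rewrite leq_min card_s /= (leq_trans (max_card _))//.
  by rewrite card_prod !card_ord mulnC.
split => //.
- apply/eqP; rewrite eq_le; apply/andP; split.
    by apply: le_trans ge_s _; apply: ereal_sup_ubound; exists s.
  apply: ge_ereal_sup => _ [s' fs' <-].
  by apply: le_trans (le_dual _ fs') _; apply: le_D; exact: PP.
- by exists s.
exists (dual_distribution N0 fs),
  [seq zhat ik.1 + v s ik.1 ik.2 | ik in [set ik : 'I_N * 'I_K | alpha s ik.1 ik.2 != 0%R]%SET].
split; [exact: max_dual| |by rewrite size_image].
(* Atoms possibly outside the listed points have zero weight, so the list carries the full mass. *)
rewrite -[RHS]/(1%R%:E) -[X in X%:E](dual_weights_sum N0 fs) -sumEFin.
apply: eq_bigr => ik _.
have [->|aik] := eqVneq (alpha s ik.1 ik.2) 0; first by rewrite mulr0 mul0e.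
rewrite diracE mem_set ?mule1//=.
by apply/fintype.imageP; exists ik; rewrite ?inE.
Qed.
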